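(* Let $V$ be an irreducible $\triangle_q$-module whose dimension is less than $d'$. Then there exist $(a,b,c)\in(\mathbb F^\times)^3$ and an integer $n$ with $0\le n\le d'-2$ such that the $\triangle_q$-module $V_n(a,b,c)$ is isomorphic to $V$.
   Context: $\mathbb F$ is an algebraically closed field and $q\in\mathbb F^\times$ is a root of unity of order $d$ with $d\notin\{1,2,4\}$. Put $d'=d$ if $d$ is odd and $d'=d/2$ if $d$ is even (so $d'$ is the order of $q^2$ and $d'\ge 3$). The universal Askey–Wilson algebra $\triangle_q$ is the unital associative $\mathbb F$-algebra with generators $A,B,C$ subject to the relations that each of $A+\frac{qBC-q^{-1}CB}{q^2-q^{-2}}$, $B+\frac{qCA-q^{-1}AC}{q^2-q^{-2}}$, $C+\frac{qAB-q^{-1}BA}{q^2-q^{-2}}$ is central; let $\alpha,\beta,\gamma$ be these three central elements multiplied by $q+q^{-1}$, respectively. For $(a,b,c,\lambda)\in(\mathbb F^\times)^4$ and $i\in\mathbb N$ set $\theta_i=a\lambda^{-1}q^{2i}+a^{-1}\lambda q^{-2i}$, $\theta_i^*=b\lambda^{-1}q^{2i}+b^{-1}\lambda q^{-2i}$, and $\varphi_i=a^{-1}b^{-1}\lambda q(q^i-q^{-i})(\lambda^{-1}q^{i-1}-\lambda q^{1-i})(q^{-i}-abc\lambda^{-1}q^{i-1})(q^{-i}-abc^{-1}\lambda^{-1}q^{i-1})$ (note $\varphi_0=0$). The Verma module $M_\lambda(a,b,c)$ is the (existing) $\triangle_q$-module with basis $\{m_i\}_{i\in\mathbb N}$ such that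 $(A-\theta_i)m_i=m_{i+1}$ and $(B-\theta_i^* )m_i=\varphi_i m_{i-1}$ for all $i\in\mathbb N$ (with $m_{-1}$ arbitrary), and on which $\alpha,\beta,\gamma$ act as the scalars $(b+b^{-1})(c+c^{-1})+(a+a^{-1})(\lambda q+\lambda^{-1}q^{-1})$, $(c+c^{-1})(a+a^{-1})+(b+b^{-1})(\lambda q+\lambda^{-1}q^{-1})$, $(a+a^{-1})(b+b^{-1})+(c+c^{-1})(\lambda q+\lambda^{-1}q^{-1})$ respectively. For $(a,b,c)\in(\mathbb F^\times)^3$ and $n\in\mathbb N$, with $\lambda=q^n$, the span $N$ of $\{m_i\}_{i\ge n+1}$ is a $\triangle_q$-submodule of $M_{q^n}(a,b,c)$, and $V_n(a,b,c):=M_{q^n}(a,b,c)/N$ is an $(n+1)$-dimensional $\triangle_q$-module. *)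

(* Defs.v *)
From HB Require Import structures.
From mathcomp Require Import all_boot all_order all_algebra.
Set Implicit Arguments. Unset Strict Implicit. Unset Printing Implicit Defensive.
Import GRing.Theory Num.Theory.
Local Open Scope ring_scope.

(* A finite-dimensional Delta_q-module of dimension m is given by the three
   m x m matrices by which A, B, C act on column vectors F^m
   (matrix product = composition of operators). *)

Section Dq.
Variable F : fieldType.

(* d' : the multiplicative order of q^2 *)
Definition dprime (d : nat) : nat := if odd d then d else d./2.

Definition Dq_elt (q : F) m (X Y Z : 'M[F]_m) : 'M[F]_m :=
  X + (q ^+ 2 - q ^- 2)^-1 *: (q *: (Y *m Z) - q^-1 *: (Z *m Y)).

Definition commutes m (X Y : 'M[F]_m) := X *m Y = Y *m X.

Definition central_in m (Z A B C : 'M[F]_m) :=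
  [/\ commutes Z A, commutes Z B & commutes Z C].

Definition is_Dq_module (q : F) m (A B C : 'M[F]_m) : Prop :=
  [/\ central_in (Dq_elt q A B C) A B C,
      central_in (Dq_elt q B C A) A B C &
      central_in (Dq_elt q C A B) A B C].

(* invariance of a subspace: rows of U represent (transposed) column vectors *)
Definition invariant m (X U : 'M[F]_m) : bool := (U *m X^T <= U)%MS.

Definition irreducible_mod m (A B C : 'M[F]_m) : Prop :=
  (0 < m)%N /\
  forall U : 'M[F]_m, invariant A U -> invariant B U -> invariant C U ->
    U = 0 \/ row_full U.

Definition mod_iso m1 m2 (A1 B1 C1 : 'M[F]_m1) (A2 B2 C2 : 'M[F]_m2) : Prop :=
  exists P : 'M[F]_(m2, m1),
    [/\ m1 = m2, \rank P = m1,
        P *m A1 = A2 *m P, P *m B1 = B2 *m P & P *m C1 = C2 *m P].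

Definition theta (q a lam : F) (i : nat) : F :=
  a * lam^-1 * q ^ (2 * i)%:Z + a^-1 * lam * q ^ (- (2 * i)%:Z).

Definition phi (q a b c lam : F) (i : nat) : F :=
  a^-1 * b^-1 * lam * q * (q ^ i%:Z - q ^ (- i%:Z))
  * (lam^-1 * q ^ (i%:Z - 1) - lam * q ^ (1 - i%:Z))
  * (q ^ (- i%:Z) - a * b * c * lam^-1 * q ^ (i%:Z - 1))
  * (q ^ (- i%:Z) - a * b * c^-1 * lam^-1 * q ^ (i%:Z - 1)).

(* A m_j = theta_j m_j + m_{j+1}   (m_{n+1} = 0 in the quotient) *)
Definition Vn_A (q a : F) (n : nat) : 'M[F]_n.+1 :=
  \matrix_(i, j) (if i == j :> nat then theta q a (q ^+ n) j
                  else if i == j.+1 :> nat then 1 else 0).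

Definition Vn_B (q a b c : F) (n : nat) : 'M[F]_n.+1 :=
  \matrix_(i, j) (if i == j :> nat then theta q b (q ^+ n) j
                  else if i.+1 == j :> nat then phi q a b c (q ^+ n) j else 0).

(* scalar by which gamma acts *)
Definition gamma_val (q a b c lam : F) : F :=
  (a + a^-1) * (b + b^-1) + (c + c^-1) * (lam * q + lam^-1 * q^-1).

(* C is determined by gamma/(q+q^{-1}) = C + (qAB - q^{-1}BA)/(q^2-q^{-2})
   acting as a scalar *)
Definition Vn_C (q a b c : F) (n : nat) : 'M[F]_n.+1 :=
  (gamma_val q a b c (q ^+ n) / (q + q^-1))%:M
  - (q ^+ 2 - q ^- 2)^-1 *:
      (q *: (Vn_A q a n *m Vn_B q a b c n) - q^-1 *: (Vn_B q a b c n *m Vn_A q a n)).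

End Dq.

(* Main.v *)
(** By Schur's lemma alpha, beta, gamma act as scalars and C can be eliminated, which
    leaves two cubic relations between A and B.  The first gives a highest vector:
    an eigenvector v of B for y + 1/y with (B - (y q^2 + y^-1 q^-2)) A v in the line
    of v.  By the second, for each root x of a certain quartic the vectors
    m_0 = v, m_(k+1) = (A - theta_k) m_k, with theta_k = x q^(2k) + x^-1 q^(-2k),
    satisfy the relations of a Verma module.  By irreducibility m_0, ..., m_n form a
    basis, so it remains to choose the root such that m_(n+1) = 0.  Comparing
    coefficients of m_(n+1) and m_(n+2) shows that if a root fails, a rational
    expression in the other roots vanishes, and then another root succeeds.

    Matrices are transposed throughout, so that A and B act on row vectors from the
    right; [a] and [b] stand for A^T and B^T. *)
Require Import Defs.
From HB Require Import structures.
From mathcomp Require Import all_boot all_order all_algebra.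
From mathcomp Require Import ring zify.
From Stdlib Require Import Classical_Prop.
Import GRing.Theory Num.Theory.
Local Open Scope ring_scope.
Set Implicit Arguments. Unset Strict Implicit. Unset Printing Implicit Defensive.

(** * Scalar parameters and the quartic *)

Section Scalars.
Variable F : fieldType.
Implicit Types (q x y u p P S E : F).

Definition symm u : F := u + u^-1.

Definition ladder q x k : F := symm (x * (q ^+ k) ^+ 2).

(* With x = a / lambda and y = b / lambda, ladder q x, ladder q y and raise_coef
   play the roles of theta_i, theta^*_i and phi_i; P and S encode gamma and the
   eigenvalue mu of a highest vector, E encodes beta. *)
Definition raise_coef q x y P S k : F :=
  let p := q ^+ k in
  (p - p^-1) * (x * y / q ^+ 2 * p ^+ 3 - q ^+ 2 / (x * y) / p ^+ 3
                + (y / x - S) * p + (P - x / y) / p).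

(** The condition under which the lowering rule with coefficients [raise_coef] is compatible with
    the second cubic relation. It is linear in [E], so proofs solve it for [E] and keep [x] free. *)
Definition quartic q y P S E x : F :=
  x ^+ 4 - y * P * x ^+ 3 + E * x ^+ 2 - y * q ^+ 2 * S * x + y ^+ 2 * q ^+ 2.

Lemma ladder0 q x : ladder q x 0 = symm x.
Proof. by rewrite /ladder !expr1n mulr1. Qed.

Lemma raise_coef0 q x y P S : raise_coef q x y P S 0 = 0.
Proof. by rewrite /raise_coef expr0 invr1 subrr mul0r. Qed.

Lemma symm_eq u x : u != 0 -> x != 0 -> symm u = symm x -> u = x \/ u * x = 1.
Proof.
move=> u0 x0 h; have : (u - x) * (u * x - 1) = 0.
  have -> : (u - x) * (u * x - 1) = u * x * (symm u - symm x).
    by rewrite /symm; field; rewrite u0 x0.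
  by rewrite h subrr mulr0.
by move/eqP; rewrite mulf_eq0 !subr_eq0 => /orP [] /eqP; [left | right].
Qed.

Lemma symm_inv u : symm u^-1 = symm u.
Proof. by rewrite /symm invrK addrC. Qed.

End Scalars.

(** * Chains under [a] and the lowering action of [b] *)

Section Chain.
Variables (F : fieldType) (m : nat) (a : 'M[F]_m) (th : nat -> F) (v : 'rV[F]_m).

Fixpoint chain k : 'rV[F]_m :=
  if k is k'.+1 then chain k' *m a - th k' *: chain k' else v.

Lemma chain_mul k : chain k *m a = chain k.+1 + th k *: chain k.
Proof. by rewrite /= subrK. Qed.

End Chain.

(** Here [u] is the vector preceding [v0]. The rule for it is stated with the factor [c0], so that
    the bottom of the chain, where [c0] is 0 and no such vector exists, is covered too. *)
Lemma expand_rel (F : fieldType) m (a b : 'M[F]_m) (u v0 v1 v2 : 'rV[F]_m)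
    th0 th1 t ts0 ts1 c0 c1 :
  v0 *m a = v1 + th0 *: v0 -> v1 *m a = v2 + th1 *: v1 ->
  v0 *m b = ts0 *: v0 + c0 *: u -> c0 *: (u *m a) = c0 *: (v0 + t *: u) ->
  v1 *m b = ts1 *: v1 + c1 *: v0 -> forall (be r : F),
  v0 *m (b *m a *m a - be *: (a *m b *m a) + a *m a *m b + r *: b) =
  ts0 *: (v2 + th1 *: v1 + th0 *: (v1 + th0 *: v0)) + c0 *: (v1 + th0 *: v0)
    + t *: (c0 *: (v0 + t *: u))
  - be *: (ts1 *: (v2 + th1 *: v1) + c1 *: (v1 + th0 *: v0)
           + th0 *: (ts0 *: (v1 + th0 *: v0) + c0 *: (v0 + t *: u)))
  + (v2 *m b + th1 *: (ts1 *: v1 + c1 *: v0)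
     + th0 *: (ts1 *: v1 + c1 *: v0 + th0 *: (ts0 *: v0 + c0 *: u)))
  + r *: (ts0 *: v0 + c0 *: u).
Proof.
move=> a0 a1 h0 hu h1 be r.
rewrite !(mulmxDr, mulmxBr, mulmxN) -!scalemxAr !mulmxA.
have t1 : v0 *m b *m a = ts0 *: (v1 + th0 *: v0) + c0 *: (v0 + t *: u).
  by rewrite h0 mulmxDl -!scalemxAl hu a0.
have t2 : v0 *m b *m a *m a = ts0 *: (v2 + th1 *: v1 + th0 *: (v1 + th0 *: v0))
    + c0 *: (v1 + th0 *: v0) + t *: (c0 *: (v0 + t *: u)).
  have -> : v0 *m b *m a = ts0 *: (v1 + th0 *: v0) + (c0 *: v0 + t *: (c0 *: u)).
    by rewrite t1 (scalerDr c0) !(scalerA c0) !(scalerA t) (mulrC c0 t).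
  rewrite !mulmxDl -!scalemxAl !mulmxDl -!scalemxAl hu a1 a0.
  by rewrite addrA.
have t3 : v0 *m a *m b *m a = ts1 *: (v2 + th1 *: v1) + c1 *: (v1 + th0 *: v0)
    + th0 *: (ts0 *: (v1 + th0 *: v0) + c0 *: (v0 + t *: u)).
  by rewrite {1}a0 !mulmxDl -!scalemxAl t1 h1 mulmxDl -!scalemxAl a0 a1.
have t4 : v0 *m a *m a *m b = v2 *m b + th1 *: (ts1 *: v1 + c1 *: v0)
    + th0 *: (ts1 *: v1 + c1 *: v0 + th0 *: (ts0 *: v0 + c0 *: u)).
  by rewrite a0 mulmxDl -scalemxAl a0 a1 !mulmxDl -!scalemxAl mulmxDl -!scalemxAl h0 h1.
by rewrite t2 t3 t4 h0.
Qed.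

Section ChainLowering.
Variables (F : fieldType) (q : F) (m : nat) (a b : 'M[F]_m).
Hypothesis q0 : q != 0.
Variables (x y P S E k2 g mu : F) (v : 'rV[F]_m).
Hypotheses (x0 : x != 0) (y0 : y != 0).
Hypothesis hg : g = (q - q^-1) ^+ 2 * (P + S).
Hypothesis hmu : mu = (q - q^-1) * (P / q - S * q).
Hypothesis hk2 : k2 = (q - q^-1) ^+ 2 * (1 + q^-2) / y * (E + y ^+ 2 + q ^+ 2).
Hypothesis hQ : quartic q y P S E x = 0.
Hypothesis rel2 : b *m a *m a - (q ^+ 2 + q ^- 2) *: (a *m b *m a) + a *m a *m b
   + (q ^+ 2 - q ^- 2) ^+ 2 *: b = k2%:M - g *: a.
Hypothesis vb : v *m b = symm y *: v.
Hypothesis vab : v *m a *m b - symm (y * q ^+ 2) *: (v *m a) = mu *: v.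

Let w := chain a (ladder q x) v.

(** The second cubic relation applied to [w i] contains [w i.+2 *m b] with coefficient 1 and
    otherwise known vectors, so the rule passes from i and i+1 to i+2. The start comes from [vb] and
    [vab]; [hQ] removes a leftover multiple of [w i]. *)
Lemma chain_lowering k :
  w k.+1 *m b = ladder q y k.+1 *: w k.+1 + raise_coef q x y P S k.+1 *: w k.
Proof.
have E_def : E = (- x ^+ 4 + y * P * x ^+ 3 + y * q ^+ 2 * S * x
     - y ^+ 2 * q ^+ 2) / x ^+ 2.
  by move: hQ; rewrite /quartic => hQ'; apply/eqP; rewrite eq_sym
    -subr_eq0 -oppr_eq0 -(mul0r (x ^- 2)) -hQ'; apply/eqP; field.
have base : w 1 *m b = ladder q y 1 *: w 1 + raise_coef q x y P S 1 *: w 0.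
  rewrite /w /= ladder0 mulmxBl -scalemxAl vb.
  have -> : v *m a *m b = mu *: v + symm (y * q ^+ 2) *: (v *m a).
    by rewrite -vab subrK.
  rewrite /ladder /raise_coef expr1 /symm hmu.
  apply/rowP => j; rewrite !mxE; field; rewrite ?q0 ?x0 ?y0 //.
have main i (u : 'rV_m) : w i *m b = ladder q y i *: w i + raise_coef q x y P S i *: u ->
   raise_coef q x y P S i *: (u *m a) =
     raise_coef q x y P S i *: (w i + symm (x * (q ^+ i / q) ^+ 2) *: u) ->
   w i.+1 *m b = ladder q y i.+1 *: w i.+1 + raise_coef q x y P S i.+1 *: w i ->
   w i.+2 *m b = ladder q y i.+2 *: w i.+2 + raise_coef q x y P S i.+2 *: w i.+1.
  move=> h0 hu h1.
  have a0 : w i *m a = w i.+1 + ladder q x i *: w i by rewrite -chain_mul.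
  have a1 : w i.+1 *m a = w i.+2 + ladder q x i.+1 *: w i.+1 by rewrite -chain_mul.
  have := expand_rel a0 a1 h0 hu h1.
  move/(_ (q ^+ 2 + q ^- 2) ((q ^+ 2 - q ^- 2) ^+ 2)); rewrite rel2 mulmxBr mul_mx_scalar -scalemxAr a0.
  set c := raise_coef q x y P S i.
  set t := symm (x * (q ^+ i / q) ^+ 2).
  move: (w i.+2 *m b) => wb; move: (w i.+2) (w i.+1) (w i) => w2 w1 w0 H.
  apply/rowP => j; move/rowP/(_ j): H; rewrite !mxE.
  move: (wb 0 j) (w2 0 j) (w1 0 j) (w0 0 j) (u 0 j) => zb z2 z1 z0 zu H.
  have qi0 : q ^+ i != 0 by rewrite expf_neq0.
  (* The expanded relation contains [zb] exactly once; subtracting it cancels [zb] and leaves an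
     identity of rational functions. *)
  have -> : zb = zb - ((k2 * z0 - g * (z1 + ladder q x i * z0)) - (k2 * z0 - g * (z1 + ladder q x i * z0))) by ring.
  rewrite [X in _ - (X - _)]H hk2 hg E_def /c /t /raise_coef /ladder /symm !exprS expr0.
  move: (q ^+ i) qi0 => p p0; field; rewrite ?p0 ?q0 ?x0 ?y0 //.
suff [] : w k.+1 *m b = ladder q y k.+1 *: w k.+1 + raise_coef q x y P S k.+1 *: w k
    /\ w k.+2 *m b = ladder q y k.+2 *: w k.+2 + raise_coef q x y P S k.+2 *: w k.+1 by [].
elim: k => [|k [IH1 IH2]].
  split=> //; apply: (main 0%N 0) => //.
    by rewrite raise_coef0 !scale0r addr0 /w /= ladder0.
  by rewrite raise_coef0 !scale0r.
split=> //; apply: (main k.+1 (w k)) => //.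
rewrite /w chain_mul -/w; congr (_ *: (_ + _ *: _)); rewrite /ladder.
by rewrite [q ^+ k.+1]exprS mulrAC divff ?mul1r.
Qed.
End ChainLowering.

(** * Bases formed by chains: coordinates, traces, coefficient relations *)

Definition pair_irreducible (F : fieldType) m (a b : 'M[F]_m) :=
  forall U : 'M[F]_m, (U *m a <= U)%MS -> (U *m b <= U)%MS -> U = 0 \/ row_full U.

Section ChainBasis.
Variables (F : fieldType) (n : nat) (a b : 'M[F]_n.+1).
Variables (th ts ph : nat -> F) (w : nat -> 'rV[F]_n.+1).
Hypothesis irr : pair_irreducible a b.
Hypothesis w0 : w 0 != 0.
Hypothesis wa : forall k, w k *m a = w k.+1 + th k *: w k.
Hypothesis ph0 : ph 0 = 0.
Hypothesis wb : forall k, w k *m b = ts k *: w k + ph k *: w k.-1.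

Definition chain_mx : 'M[F]_n.+1 := \matrix_(i < n.+1) w i.
Local Notation W := chain_mx.

(** If [w k] lies in the span of its predecessors, that span is stable under [a] and [b], hence
    everything. So the spans gain rank at every step until they fill the space. *)
Lemma chain_mx_unit : W \in unitmx.
Proof.
pose U k : 'M_n.+1 := (\sum_(i < k) <<w i>>)%MS.
have memU i k : (i < k)%N -> (w i <= U k)%MS.
  move=> ik; rewrite /U (submx_trans _ (sumsmx_sup (Ordinal ik) _ (submx_refl _))) //=.
  by rewrite genmxE.
have growth k : (k <= \rank (U k))%N || row_full (U k).
  elim: k => [|k IH]; first by rewrite leq0n.
  have sub : (U k <= U k.+1)%MS by rewrite /U big_ord_recr /= addsmxSl.
  have [full|nfull] := boolP (row_full (U k)).
    apply/orP; right; rewrite -sub1mx; apply: submx_trans sub.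
    by rewrite sub1mx.
  move: IH; rewrite (negbTE nfull) orbF => rk.
  have [inU|ninU] := boolP (w k <= U k)%MS; last first.
    rewrite (leq_ltn_trans rk) //; apply: rank_ltmx.
    by rewrite ltmxE sub; apply: contra ninU; apply: submx_trans; apply: memU.
  have step i : (i <= k)%N -> (w i <= U k)%MS.
    by rewrite leq_eqVlt => /orP [/eqP -> | /memU].
  case: k => [|k] in rk nfull inU step sub *.
    by move: inU w0; rewrite /U big_ord0 submx0 => ->.
  have stab (f : 'M_n.+1) : (forall i, (i <= k)%N -> (w i *m f <= U k.+1)%MS) ->
      (U k.+1 *m f <= U k.+1)%MS.
    move=> h; rewrite {1}/U sumsmxMr; apply/sumsmx_subP => i _.
    by rewrite (eqmxMr _ (genmxE _)) h // -ltnS.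
  case: (irr (U := U k.+1)) => [||U0|full].
  - apply: stab => i ik; rewrite wa addmx_sub ?scalemx_sub //; apply: step => //.
    exact: leqW.
  - apply: stab => i ik; rewrite wb addmx_sub ?scalemx_sub //; apply: step.
      exact: leqW.
    exact: leq_trans (leq_pred _) (leqW ik).
  - by move: (memU 0%N k.+1 isT); rewrite U0 submx0 (negbTE w0).
  - by rewrite full in nfull.
have full : row_full (U n.+1).
  case/orP: (growth n.+1) => // h; rewrite /row_full eqn_leq h andbT.
  exact: rank_leq_row.
rewrite -row_full_unit -sub1mx; move: full; rewrite -sub1mx => /submx_trans; apply.
apply/sumsmx_subP => i _; rewrite genmxE.
by rewrite -[w i](rowK (fun i : 'I_n.+1 => w i)) row_sub.
Qed.

(** The value 0 beyond [n] lets [coord_mulb] hold at the top index without a separate case. *)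
Definition coord i (v : 'rV[F]_n.+1) : F :=
  if (i < n.+1)%N then (v *m invmx W) 0 (inord i) else 0.

Lemma coordD i u v : coord i (u + v) = coord i u + coord i v.
Proof. by rewrite /coord; case: ifP; rewrite ?addr0 // mulmxDl mxE. Qed.

Lemma coordZ i c v : coord i (c *: v) = c * coord i v.
Proof. by rewrite /coord; case: ifP; rewrite ?mulr0 // -scalemxAl mxE. Qed.

Lemma coord_chain i j : (j <= n)%N -> coord i (w j) = (i == j)%:R.
Proof.
move=> jn; rewrite /coord; case: ltnP => [ilt|]; last by case: eqVneq => // ->; lia.
have -> : w j *m invmx W = row (inord j) (W *m invmx W).
  by rewrite row_mul rowK inordK.
by rewrite mulmxV ?chain_mx_unit // row1 mxE eqxx /= -val_eqE /= !inordK.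
Qed.

Lemma coord_sum v : v = \sum_(j < n.+1) coord j v *: w j.
Proof.
rewrite -[LHS](mulmxKV chain_mx_unit) mulmx_sum_row; apply: eq_bigr => j _.
by rewrite rowK /coord ltn_ord inord_val.
Qed.

Lemma coord_eq0 v : (forall i, (i <= n)%N -> coord i v = 0) -> v = 0.
Proof.
move=> h; rewrite (coord_sum v) big1 // => j _; rewrite h ?scale0r //.
by rewrite -ltnS.
Qed.

Lemma coord_over i v : (n < i)%N -> coord i v = 0.
Proof. by move=> ni; rewrite /coord ifN // -leqNgt. Qed.

Lemma coord_mul f i v :
  coord i (v *m f) = \sum_(j < n.+1) coord j v * coord i (w j *m f).
Proof.
rewrite {1}(coord_sum v) mulmx_suml.
elim/big_rec2: _ => [|j s1 s2 _ IH]; last by rewrite coordD -scalemxAl coordZ IH.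
by rewrite -[0](scale0r 0) coordZ mul0r.
Qed.

Lemma sum_coord_pick (i : nat) v (f : nat -> F) :
  \sum_(j < n.+1) coord j v * (f j * (i == j :> nat)%:R) = f i * coord i v.
Proof.
have [ile|igt] := leqP i n; last first.
  rewrite coord_over // mulr0 big1 // => j _.
  have -> : (i == j :> nat) = false.
    by apply/eqP => ij; move: (ltn_ord j); rewrite -ij ltnS leqNgt igt.
  by rewrite !mulr0.
rewrite (bigD1 (inord i)) //= inordK // eqxx mulr1 big1 => [|j].
  by rewrite addr0 mulrC.
rewrite -val_eqE /= inordK // eq_sym => /negbTE ->.
by rewrite !mulr0.
Qed.

Lemma coord_mulb i v :
  coord i (v *m b) = ts i * coord i v + ph i.+1 * coord i.+1 v.
Proof.
rewrite coord_mul -(sum_coord_pick i v ts) -(sum_coord_pick i.+1 v ph) -big_split /=.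
apply: eq_bigr => j _; rewrite wb coordD !coordZ -mulrDr; congr (_ * (_ + _)).
  by rewrite coord_chain // -ltnS.
rewrite coord_chain; last by have := ltn_ord j; lia.
by case: j => [[|j] lj] /=; rewrite ?ph0 ?mul0r // eqSS.
Qed.

Lemma coord_mula i v : (i <= n)%N -> coord i (v *m a) =
  th i * coord i v + (if i is j.+1 then coord j v else 0) + coord n v * coord i (w n.+1).
Proof.
move=> ile; rewrite coord_mul.
have -> : \sum_(j < n.+1) coord j v * coord i (w j *m a) =
   \sum_(j < n.+1) coord j v * (th j * (i == j :> nat)%:R)
   + \sum_(j < n.+1) coord j v * coord i (w j.+1).
  rewrite -big_split /=; apply: eq_bigr => j _; rewrite wa coordD coordZ -mulrDr /=.
  by rewrite (coord_chain i (j := j)) 1?addrC // -ltnS.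
rewrite sum_coord_pick -addrA; congr (_ + _).
rewrite big_ord_recr /=; congr (_ + _).
case: i ile => [|i] ile.
  by rewrite big1 // => j _; rewrite coord_chain ?mulr0.
rewrite (bigD1 (Ordinal ile)) //= coord_chain // eqxx mulr1 big1 ?addr0 // => j.
rewrite -val_eqE /= => /negbTE ji; rewrite coord_chain // eqSS eq_sym ji.
by rewrite mulr0.
Qed.

Lemma trace_coord f : \tr f = \sum_(i < n.+1) coord i (w i *m f).
Proof.
rewrite -[f in LHS]mulmx1 -(mulVmx chain_mx_unit) mulmxA mxtrace_mulC mulmxA.
apply: eq_bigr => i _; rewrite /coord ltn_ord inord_val.
have -> : w i = row i W by rewrite rowK.
by rewrite -!row_mul [RHS]mxE.
Qed.

(** In the chain basis [b] is triangular with diagonal [ts]. *)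
Lemma trace_b : \tr b = \sum_(i < n.+1) ts i.
Proof.
rewrite trace_coord; apply: eq_bigr => i _; rewrite coord_mulb !coord_chain -1?ltnS //.
by rewrite eqxx mulr1 eqn_leq ltnn /= mulr0 addr0.
Qed.

(** Besides [th], only the last basis vector contributes to the diagonal, through the [w n]
    component of [w n.+1]. *)
Lemma trace_a : \tr a = \sum_(i < n.+1) th i + coord n (w n.+1).
Proof.
rewrite trace_coord.
under eq_bigr => i _ do rewrite wa addrC coordD coordZ coord_chain -1?ltnS // eqxx mulr1.
rewrite big_split /=; congr (_ + _); rewrite big_ord_recr /= big1 ?add0r // => i _.
by rewrite coord_chain // eqn_leq ltnn andbF.
Qed.

Let c i := coord i (w n.+1).

(** The coefficient of [w i] in [w n.+1 *m b] is computed twice: from the expansion of [w n.+1] in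
    the basis and from the lowering rule. *)
Lemma chain_coef_rel i : (i <= n)%N ->
  ts i * c i + ph i.+1 * c i.+1 = ts n.+1 * c i + (i == n)%:R * ph n.+1.
Proof.
move=> ile; rewrite /c -coord_mulb wb coordD !coordZ (coord_chain i (leqnn n)).
by rewrite [_%:R * _]mulrC.
Qed.

(** The coefficients of [w n.+2], obtained by applying [a] to the expansion of [w n.+1]; the absent
    coefficient below index 0 is read as 0. *)
Let e i := (if i is j.+1 then c j else 0) + (th i - th n.+1) * c i + c n * c i.

Lemma chain_coef2E i : (i <= n)%N -> e i = coord i (w n.+2).
Proof.
move=> ile; have -> : w n.+2 = w n.+1 *m a + (- th n.+1) *: w n.+1.
  by rewrite wa scaleNr addrK.
by rewrite coordD coordZ coord_mula // /e /c; case: i ile => *; ring.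
Qed.

Lemma chain_coef_rel2 i : (i < n)%N ->
  ts i * e i + ph i.+1 * e i.+1 = ts n.+2 * e i + ph n.+2 * c i.
Proof.
move=> ilt; rewrite !chain_coef2E ?(ltnW ilt) // -coord_mulb wb.
by rewrite coordD !coordZ.
Qed.

Lemma chain_coef_rel2_last : ts n * e n = ts n.+2 * e n + ph n.+2 * c n.
Proof.
have := coord_mulb n (w n.+2); rewrite (coord_over (i := n.+1)) // mulr0 addr0 chain_coef2E //.
by move=> <-; rewrite wb coordD !coordZ.
Qed.

End ChainBasis.

(** * Sums and coincidences of ladder values *)

Section LadderSums.
Variables (F : fieldType) (q : F).
Hypothesis q0 : q != 0.

Lemma ladder_shift x s k : ladder q x (s + k) = ladder q (x * (q ^+ s) ^+ 2) k.
Proof. by rewrite /ladder exprD exprMn mulrA. Qed.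

Lemma sum_ladder x n : x != 0 ->
  (q - q^-1) * (\sum_(i < n.+1) ladder q x i)
  = (q ^+ n.+1 - q ^- n.+1) * symm (x * q ^+ n).
Proof.
move=> x0; elim: n => [|n IH].
  by rewrite big_ord1 ladder0 expr0 expr1 mulr1.
rewrite big_ord_recr /= mulrDr IH /ladder /symm !exprS.
by move: (q ^+ n) (expf_neq0 n q0) => p p0; field; rewrite p0 q0 x0.
Qed.

Lemma ladder_eq y i j : y != 0 -> (i <= j)%N -> ladder q y i = ladder q y j ->
  (q ^+ (j - i)) ^+ 2 = 1 \/ (y * q ^+ (i + j)) ^+ 2 = 1.
Proof.
move=> y0 ij; rewrite /ladder => /symm_eq [||h|h].
- by rewrite mulf_neq0 ?expf_neq0.
- by rewrite mulf_neq0 ?expf_neq0.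
- left; apply: (mulfI (expf_neq0 2 (expf_neq0 i q0))).
  by rewrite mulr1 -exprMn -exprD subnKC // -(mulfI y0 h).
- by right; rewrite -h exprD; ring.
Qed.

End LadderSums.

(** * Rational identities for passing from one root to another *)

Section RootSwitch.
Variables (F : fieldType) (q : F).
Hypothesis q0 : q != 0.
Implicit Types (x y p P S : F).

(** What is left of [raise_coef], as a polynomial in t = q^(2k), once the factor vanishing at k = 0
    and powers of q are split off. *)
Definition raise_cubic x y P S t : F :=
  x * y / q ^+ 2 * t ^+ 3 + (y / x - S) * t ^+ 2 + (P - x / y) * t - q ^+ 2 / (x * y).

Lemma raise_coefE x y P S k : x != 0 -> y != 0 ->
  raise_coef q x y P S k =
  (q ^+ k - q ^- k) / (q ^+ k) ^+ 3 * raise_cubic x y P S ((q ^+ k) ^+ 2).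
Proof.
move=> x0 y0; have p0 := expf_neq0 k q0; rewrite /raise_coef /raise_cubic.
by move: (q ^+ k) p0 => p p0; field; rewrite p0 q0 x0 y0.
Qed.

(** The left side is what remains after eliminating c_n between [last_coef_rel] and
    [last_coef_rel2], taken at n+1. The factor (y p)^2 - 1 on the right makes the identity void for
    y p = 1 or -1; [elimination_square_one] serves that case. *)
Lemma elimination_generic x y P S n : x != 0 -> y != 0 ->
  let p := q ^+ n.+1 in
  let D1 := ladder q y n.+1 - ladder q y n.+2 in
  let D2 := ladder q y n - ladder q y n.+2 in
  let D3 := ladder q y n.+1 - ladder q y n.+3 in
  D2 * D3 * raise_coef q x y P S n.+2 - D3 * D1 * raise_coef q x y P S n.+1
  - D1 * D2 * raise_coef q x y P S n.+3
  + D1 * D2 * D3 * (ladder q x n.+1 - ladder q x n.+2)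
  = (q ^+ 2 - q ^- 2) ^+ 2 * (q - q^-1) ^+ 2 * (y * p) ^+ 2 * ((y * p) ^+ 2 - 1)
    * raise_cubic x y P S ((y * p) ^- 2).
Proof.
move=> x0 y0; have p0 := expf_neq0 n q0.
rewrite /raise_coef /raise_cubic /ladder /symm !exprS expr0 /=.
by move: (q ^+ n) p0 => p p0; field; rewrite p0 q0 x0 y0.
Qed.

(** Uses the coefficient relations at index 0 instead of those at the top; [c] is the value of c_n
    dictated by [last_coef_rel]. *)
Lemma elimination_square_one x y P S n : q ^+ 2 != 1 -> x != 0 -> y != 0 ->
  let p := q ^+ n in
  (y * p) ^+ 2 = 1 -> (q ^+ n.+1) ^+ 2 != 1 ->
  let c := raise_coef q x y P S n.+1 / (ladder q y n - ladder q y n.+1) in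
  (ladder q y 0 - ladder q y n.+2) * (ladder q x 0 - ladder q x n.+1 + c)
  + raise_coef q x y P S 1
  + (ladder q x 1 - ladder q x n.+1 + c) * (ladder q y n.+1 - ladder q y 0)
  - raise_coef q x y P S n.+2
  = (q ^+ 2 - q ^- 2) * raise_cubic x y P S 1.
Proof.
move=> nq1 x0 y0 /= yp1 nq; have p0 := expf_neq0 n q0.
have y_def : y = (q ^+ n)^-1 \/ y = - (q ^+ n)^-1.
  have : (y * q ^+ n == 1) || (y * q ^+ n == -1) by rewrite -sqrf_eq1 yp1.
  by case/orP => /eqP h; [left | right]; rewrite -[y](mulfK p0) h ?mul1r ?mulN1r.
rewrite /raise_coef /raise_cubic /ladder /symm !exprS expr0.
move: nq; rewrite [q ^+ n.+1]exprS.
move: (q ^+ n) p0 y_def => p p0 y_def nq.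
have nz : q ^+ 2 * p ^+ 2 - 1 != 0.
  by rewrite subr_eq0 -exprMn.
have q1 : q ^+ 2 - 1 != 0 by rewrite subr_eq0.
case: y_def => ->; field; rewrite p0 x0 q0 ?oppr_eq0 oner_neq0 /=;
  rewrite (_ : _ - _ = - ((q ^+ 2 - 1) * (q ^+ 2 * p ^+ 2 - 1))); try ring;
  by rewrite oppr_eq0 mulf_neq0.
Qed.

(* The four roots of the quartic multiply to y^2 q^2.  The vanishing of the cubic
   makes (y p q)^2 / x a root, and the other two are x3 and 1/(p^2 x3). *)
Lemma switched_root x x3 y P S E p : x != 0 -> x3 != 0 -> y != 0 -> p != 0 ->
  quartic q y P S E x = 0 -> raise_cubic x y P S ((y * p) ^- 2) = 0 ->
  x3 + (p ^+ 2 * x3)^-1 = y * P - x - (y * p * q) ^+ 2 / x ->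
  quartic q y P S E x3 = 0 /\ raise_cubic x3 y P S ((q * p) ^+ 2) = 0.
Proof.
move=> x0 x30 y0 p0 hQ hc hx3.
(* The three hypotheses are linear in [P], [S] and [E] respectively; solving for these turns both
   claims into rational identities. *)
have P_def : P = (x3 + (p ^+ 2 * x3)^-1 + x + (y * p * q) ^+ 2 / x) / y.
  by rewrite hx3; field; rewrite x0 y0.
have S_def : S = (x * y / q ^+ 2 * ((y * p) ^- 2) ^+ 3 + y / x * ((y * p) ^- 2) ^+ 2
   + (P - x / y) * (y * p) ^- 2 - q ^+ 2 / (x * y)) / ((y * p) ^- 2) ^+ 2.
  rewrite -[LHS]addr0 -(mul0r (((y * p) ^- 2) ^+ 2)^-1) -hc /raise_cubic.
  by field; rewrite p0 y0 oner_neq0 x0.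
have E_def : E = (- x ^+ 4 + y * P * x ^+ 3 + y * q ^+ 2 * S * x
     - y ^+ 2 * q ^+ 2) / x ^+ 2.
  rewrite -[LHS]subr0 -(mul0r (x ^+ 2)^-1) -hQ /quartic.
  by field; rewrite x0.
rewrite /quartic /raise_cubic E_def S_def P_def.
by split; field; rewrite ?oner_neq0 p0 y0 x0 x30 q0.
Qed.

(* The case y^2 p^4 q^2 = 1 is the one where ladder q y takes the same value at
   n and n+1, so that the relation for c_n is void. *)
Lemma switched_trace x x3 y P S n c : x != 0 -> x3 != 0 -> y != 0 ->
  let p := q ^+ n.+1 in
  (y * p ^+ 2 * q) ^+ 2 = 1 -> raise_cubic x y P S ((y * p) ^- 2) = 0 ->
  x3 + (p ^+ 2 * x3)^-1 = y * P - x - (y * p * q) ^+ 2 / x ->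
  let D2 := ladder q y n - ladder q y n.+2 in
  let D3 := ladder q y n.+1 - ladder q y n.+3 in
  D2 != 0 -> D3 != 0 ->
  D3 * (D2 * (ladder q x n.+1 - ladder q x n.+2 + c) - raise_coef q x y P S n.+1)
    = D2 * raise_coef q x y P S n.+3 ->
  (q - q^-1) * c = (q * p - (q * p)^-1) * (symm (x3 * p) - symm (x * p)).
Proof.
move=> x0 x30 y0 p ypq hc hx3 D2 D3 D20 D30 hD.
have p0 : p != 0 by rewrite expf_neq0.
(* The squared condition leaves two explicit values of [y]; with [P], [S] and [c] solved for, each
   of them gives a rational identity. *)
have y_def : y = (p ^+ 2 * q)^-1 \/ y = - (p ^+ 2 * q)^-1.
  have pq0 : p ^+ 2 * q != 0 by rewrite mulf_neq0 ?expf_neq0.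
  have : (y * (p ^+ 2 * q) == 1) || (y * (p ^+ 2 * q) == -1).
    by rewrite -sqrf_eq1 mulrA ypq.
  by case/orP => /eqP h; [left | right]; rewrite -[y](mulfK pq0) h ?mul1r ?mulN1r.
have P_def : P = (x3 + (p ^+ 2 * x3)^-1 + x + (y * p * q) ^+ 2 / x) / y.
  by rewrite hx3; field; rewrite x0 y0.
have D2E : D2 = y * (p / q) ^+ 2 + (y * (p / q) ^+ 2)^-1
   - (y * (p * q) ^+ 2 + (y * (p * q) ^+ 2)^-1).
  rewrite /D2 /ladder /symm /p !exprS; move: (q ^+ n) (expf_neq0 n q0) => r r0.
  by field; rewrite r0 q0 y0.
have D3E : D3 = y * p ^+ 2 + (y * p ^+ 2)^-1
   - (y * (p * q ^+ 2) ^+ 2 + (y * (p * q ^+ 2) ^+ 2)^-1).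
  rewrite /D3 /ladder /symm /p !exprS; move: (q ^+ n) (expf_neq0 n q0) => r r0.
  by field; rewrite r0 q0 y0.
have c_def : D2 * D3 * c = D2 * raise_coef q x y P S n.+3
    + D3 * raise_coef q x y P S n.+1
    - D2 * D3 * (ladder q x n.+1 - ladder q x n.+2) by rewrite -hD; ring.
apply: (mulfI (mulf_neq0 D20 D30)); rewrite mulrCA c_def.
have S_def : S = (x * y / q ^+ 2 * ((y * p) ^- 2) ^+ 3 + y / x * ((y * p) ^- 2) ^+ 2
   + (P - x / y) * (y * p) ^- 2 - q ^+ 2 / (x * y)) / ((y * p) ^- 2) ^+ 2.
  rewrite -[LHS]addr0 -(mul0r (((y * p) ^- 2) ^+ 2)^-1) -hc /raise_cubic.
  by field; rewrite p0 y0 oner_neq0 x0.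
rewrite D2E D3E S_def P_def /raise_coef /ladder /symm.
have -> : q ^+ n.+2 = q * p by rewrite exprS.
have -> : q ^+ n.+3 = q * q * p by rewrite exprS exprS mulrA.
rewrite -/p; clearbody p.
by case: y_def => ->; field; rewrite ?oppr_eq0 oner_neq0 p0 x0 x30 q0.
Qed.

End RootSwitch.

(** * A root whose chain terminates *)

Section TerminatingRoot.
Variables (F : closedFieldType) (q : F) (n : nat) (a b : 'M[F]_n.+1).
Variables (y P S E k2 g mu : F) (v : 'rV[F]_n.+1).
Hypothesis q0 : q != 0.
Hypothesis q_order : forall k, (0 < k <= n.+1)%N -> (q ^+ k) ^+ 2 != 1.
Hypothesis n0 : (0 < n)%N.
Hypothesis y0 : y != 0.
Hypothesis v0 : v != 0.
Hypothesis irr : pair_irreducible a b.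
Hypothesis hg : g = (q - q^-1) ^+ 2 * (P + S).
Hypothesis hmu : mu = (q - q^-1) * (P / q - S * q).
Hypothesis hk2 : k2 = (q - q^-1) ^+ 2 * (1 + q^-2) / y * (E + y ^+ 2 + q ^+ 2).
Hypothesis rel2 : b *m a *m a - (q ^+ 2 + q ^- 2) *: (a *m b *m a) + a *m a *m b
   + (q ^+ 2 - q ^- 2) ^+ 2 *: b = k2%:M - g *: a.
Hypothesis vb : v *m b = symm y *: v.
Hypothesis vab : v *m a *m b - symm (y * q ^+ 2) *: (v *m a) = mu *: v.

Local Notation w x := (chain a (ladder q x) v).
Local Notation ts := (ladder q y).
Local Notation ph x := (raise_coef q x y P S).
Local Notation Q := (quartic q y P S E).

Lemma quartic_root_neq0 x : Q x = 0 -> x != 0.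
Proof.
move=> hx; apply/eqP => x0; move: hx; rewrite x0 /quartic !expr0n /= !mulr0.
by rewrite subr0 subr0 add0r add0r => /eqP; rewrite mulf_eq0 !expf_eq0 /= (negbTE y0) (negbTE q0).
Qed.

Lemma quartic_has_root : exists x, Q x = 0.
Proof.
have [x hx] := solve_monicpoly (nth 0 [:: - (y ^+ 2 * q ^+ 2); y * q ^+ 2 * S; - E; y * P])
  (isT : (0 < 4)%N).
exists x; rewrite /quartic hx !big_ord_recr big_ord0 /=; ring.
Qed.

Lemma root_chain_a x k : w x k *m a = w x k.+1 + ladder q x k *: w x k.
Proof. exact: chain_mul. Qed.

Lemma root_chain_b x k : Q x = 0 -> w x k *m b = ts k *: w x k + ph x k *: w x k.-1.
Proof.
move=> hx; case: k => [|k].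
  by rewrite raise_coef0 scale0r addr0 ladder0.
by apply: (chain_lowering q0 _ y0 hg hmu hk2 hx) => //; apply: quartic_root_neq0.
Qed.

Lemma trace_b_chain : (q - q^-1) * \tr b = (q ^+ n.+1 - q ^- n.+1) * symm (y * q ^+ n).
Proof.
have [x hx] := quartic_has_root.
rewrite (trace_b irr v0 (root_chain_a x) (raise_coef0 _ _ _ _ _) (fun k => root_chain_b k hx)).
exact: sum_ladder.
Qed.

Lemma q_bracket : q ^+ n.+1 - q ^- n.+1 != 0.
Proof.
have qn0 := expf_neq0 n.+1 q0.
rewrite -(inj_eq (mulfI qn0)) mulrBr mulfV // mulr0 subr_eq0 -expr2.
by rewrite q_order // ltnS leqnn.
Qed.

(** As the coefficient at [s] vanishes, the vectors from [w x s] on form a chain of their own, hence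
    a basis. The trace of [b] is thus also a ladder sum starting at y q^(2s); comparing it with the
    one starting at y leaves this possibility, because q^(2s) is not 1. *)
Lemma trace_tail x s : Q x = 0 -> (0 < s <= n.+1)%N -> ph x s = 0 -> w x s != 0 ->
  (y * q ^+ (n + s)) ^+ 2 = 1.
Proof.
move=> hx hs phs ws.
have wb' k : w x (s + k) *m b =
    ladder q (y * (q ^+ s) ^+ 2) k *: w x (s + k) + ph x (s + k) *: w x (s + k.-1).
  rewrite root_chain_b // -ladder_shift; congr (_ + _).
  by case: k => [|k]; rewrite ?addn0 ?phs ?scale0r // addnS.
have wa' k : w x (s + k) *m a = w x (s + k.+1) + ladder q x (s + k) *: w x (s + k).
  by rewrite addnS root_chain_a.
have := @trace_b _ n a b (fun k => ladder q x (s + k)) _ _ (fun k => w x (s + k)) irr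
  _ wa' _ wb'.
rewrite !addn0 => /(_ ws phs) tr2; have := trace_b_chain.
rewrite tr2 sum_ladder ?mulf_neq0 ?expf_neq0 // => /(mulfI q_bracket) /symm_eq [||h|h].
- by rewrite !mulf_neq0 ?expf_neq0.
- by rewrite mulf_neq0 ?expf_neq0.
- have yq0 : y * q ^+ n != 0 by rewrite mulf_neq0 ?expf_neq0.
  case/eqP: (q_order hs); apply: (mulfI yq0).
  by rewrite mulr1 -[RHS]h mulrAC.
- by rewrite -h exprD; ring.
Qed.

Lemma chain_neq0 x k : Q x = 0 -> (k <= n)%N -> w x k != 0.
Proof.
move=> hx kn; apply/eqP => wk0.
have := coord_chain irr v0 (root_chain_a x) (fun k => root_chain_b k hx) k kn.
by rewrite wk0 eqxx -[0](scale0r 0) coordZ mul0r => /eqP; rewrite eq_sym oner_eq0.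
Qed.

Let c x i := coord (w x) i (w x n.+1).

Lemma coef_rel x i : Q x = 0 -> (i <= n)%N ->
  ts i * c x i + ph x i.+1 * c x i.+1 = ts n.+1 * c x i + (i == n)%:R * ph x n.+1.
Proof.
move=> hx; apply: (chain_coef_rel irr v0 (root_chain_a x) _ (fun k => root_chain_b k hx)).
exact: raise_coef0.
Qed.

(** If [w x n.+1] were nonzero, [trace_tail] with s = n+1 would give the exceptional equation, so
    c_n = 0. Then [coef_rel] kills the lower coefficients one after another, as [ts] takes the value
    [ts n.+1] at none of these indices. *)
Lemma chain_end x : Q x = 0 -> ph x n.+1 = 0 ->
  ((y * q ^+ (n + n.+1)) ^+ 2 = 1 -> c x n = 0) -> w x n.+1 = 0.
Proof.
move=> hx phn hc; apply/eqP; apply/negPn/negP => wn.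
have hy := trace_tail hx (_ : (0 < n.+1 <= n.+1)%N) phn wn.
rewrite leqnn in hy; have {}hy := hy isT.
have c0 i : (i <= n)%N -> c x (n - i) = 0.
  elim: i => [|i IH] ile; first by rewrite subn0 hc.
  have := coef_rel hx (leq_subr i.+1 n).
  rewrite subnSK // IH 1?ltnW // mulr0 phn mulr0 !addr0 => /eqP.
  rewrite -subr_eq0 -mulrBl mulf_eq0 => /orP [|/eqP //]; rewrite subr_eq0 => /eqP.
  case/(ladder_eq q0 y0) => [|h|h]; first by lia.
    have : (q ^+ (n.+1 - (n - i.+1))) ^+ 2 != 1 by apply: q_order; lia.
    by rewrite h eqxx.
  have : (q ^+ i.+1) ^+ 2 != 1 by rewrite q_order //; lia.
  case/eqP; rewrite -[RHS]hy (_ : (n + n.+1)%N = n - i.+1 + n.+1 + i.+1)%N; last by lia.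
  by rewrite exprD mulrA [RHS]exprMn h mul1r.
apply/negP: wn; rewrite negbK; apply/eqP.
apply: (coord_eq0 irr v0 (root_chain_a x) (fun k => root_chain_b k hx)) => i ile.
by rewrite -(subKn ile); apply: c0; apply: leq_subr.
Qed.

Lemma coef_over x : c x n.+1 = 0.
Proof. by rewrite /c coord_over. Qed.

Lemma q2_neq1 : q ^+ 2 != 1.
Proof. by have := @q_order 1; rewrite expr1; apply. Qed.

Lemma q4_neq1 : (q ^+ 2) ^+ 2 != 1.
Proof. by apply: q_order; lia. Qed.

Lemma qV_neq0 : q - q^-1 != 0.
Proof.
rewrite subr_eq0; apply/eqP => h.
by have := q2_neq1; rewrite expr2 {1}h mulVf ?eqxx.
Qed.

Lemma qV2_neq0 : q ^+ 2 - q ^- 2 != 0.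
Proof.
rewrite subr_eq0; apply/eqP => h.
by have := q4_neq1; rewrite expr2 {1}h mulVf ?expf_neq0 ?eqxx.
Qed.

Lemma trace_a_root x : Q x = 0 ->
  (q - q^-1) * \tr a =
  (q ^+ n.+1 - q ^- n.+1) * symm (x * q ^+ n) + (q - q^-1) * c x n.
Proof.
move=> hx; rewrite (trace_a irr v0 (root_chain_a x) (fun k => root_chain_b k hx)) mulrDr sum_ladder //.
exact: quartic_root_neq0.
Qed.

Section NonzeroLast.
Variable x : F.
Hypotheses (hx : Q x = 0) (cn0 : c x n != 0).
Let p := q ^+ n.
Let x0 : x != 0 := quartic_root_neq0 hx.
Let p0 : p != 0 := expf_neq0 n q0.

Lemma last_coef_rel : ph x n.+1 = (ts n - ts n.+1) * c x n.
Proof.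
have := coef_rel hx (leqnn n); rewrite coef_over mulr0 addr0 eqxx mul1r mulrBl => ->.
by ring.
Qed.

(** Eliminates c_(n-1) between the relation at n-1 for [w n.+1] and the one at n for [w n.+2], and
    divides by c_n. *)
Lemma last_coef_rel2 :
  (ts n - ts n.+2) * ((ts n.-1 - ts n.+1) * (ladder q x n - ladder q x n.+1 + c x n)
    - ph x n) = (ts n.-1 - ts n.+1) * ph x n.+2.
Proof.
have := chain_coef_rel2_last irr v0 (root_chain_a x) (raise_coef0 _ _ _ _ _) (fun k => root_chain_b k hx).
have -> : forall f : nat -> F, (if n is j.+1 then f j else 0) = f n.-1.
  by move: n0; case: (n).
rewrite -/(c x n) -/(c x n.-1).
have := coef_rel hx (leq_pred n); rewrite prednK // (_ : (n.-1 == n) = false); last by lia.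
rewrite mul0r addr0.
move: (c x n) (c x n.-1) cn0 => cn cp cn0' hp hl.
apply: (mulIf cn0'); apply/eqP; rewrite -subr_eq0; apply/eqP.
transitivity ((ts n.-1 - ts n.+1) * (ts n * (cp + (ladder q x n - ladder q x n.+1) * cn + cn * cn)
  - (ts n.+2 * (cp + (ladder q x n - ladder q x n.+1) * cn + cn * cn) + ph x n.+2 * cn))
  - (ts n - ts n.+2) * (ts n.-1 * cp + ph x n * cn - ts n.+1 * cp)).
  by ring.
by rewrite hl hp !subrr !mulr0 subrr.
Qed.

Lemma cubic_zero_generic : (y * p) ^+ 2 != 1 -> raise_cubic q x y P S ((y * p) ^- 2) = 0.
Proof.
move=> yp1; have := elimination_generic q0 P S n.-1 x0 y0; rewrite !prednK // -/p /=.
have -> : forall D1 D2 D3 A B C T : F, D2 * D3 * A - D3 * D1 * B - D1 * D2 * C + D1 * D2 * D3 * T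
   = D2 * D3 * (A - D1 * c x n) + D1 * (D3 * (D2 * (T + c x n) - B) - D2 * C).
  by move=> *; ring.
rewrite -last_coef_rel last_coef_rel2 !subrr !mulr0 addr0 => h.
have nz : (q ^+ 2 - q ^- 2) ^+ 2 * (q - q^-1) ^+ 2 * (y * p) ^+ 2 * ((y * p) ^+ 2 - 1) != 0.
  by rewrite mulf_neq0 ?subr_eq0 // mulf_neq0 ?expf_neq0 // ?mulf_neq0 ?qV2_neq0 ?qV_neq0.
by apply: (mulfI nz); rewrite mulr0 -h.
Qed.

(** Here [trace_tail] forces [ph x k] to be nonzero for 0 < k <= n, so nonvanishing descends from
    c_n to c_0. Eliminating c_1 from the two relations at index 0 and dividing by c_0 gives the
    hypothesis of [elimination_square_one]'s left side being 0. *)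
Lemma cubic_zero_square_one : (y * p) ^+ 2 = 1 -> raise_cubic q x y P S ((y * p) ^- 2) = 0.
Proof.
move=> yp1; rewrite yp1 invr1.
have q_sq k : (0 < k <= n.+1)%N -> (y * q ^+ (n + k)) ^+ 2 != 1.
  by move=> hk; rewrite exprD mulrA [X in X != 1]exprMn yp1 mul1r q_order.
have ts_neq k : (k <= n)%N -> ts k - ts n.+1 != 0.
  move=> kn; rewrite subr_eq0; apply/eqP => /(ladder_eq q0 y0 (leqW kn)) [] h.
    have : (q ^+ (n.+1 - k)) ^+ 2 != 1 by apply: q_order; lia.
    by rewrite h eqxx.
  have : (y * q ^+ (n + k.+1)) ^+ 2 != 1 by apply: q_sq; lia.
  by rewrite addnS -addSn addnC h eqxx.
have ph_neq k : (0 < k <= n)%N -> ph x k != 0.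
  case/andP => k0 kn; apply/eqP => h.
  have hk : (0 < k <= n.+1)%N by rewrite k0 leqW.
  have := q_sq _ hk.
  by rewrite (trace_tail hx hk h (chain_neq0 hx kn)) eqxx.
have c_neq i : (i <= n)%N -> c x (n - i) != 0.
  elim: i => [|i IH] ile; first by rewrite subn0.
  have := coef_rel hx (leq_subr i.+1 n).
  rewrite subnSK // (_ : (_ == n) = false); last by lia.
  rewrite mul0r addr0 => h; apply/eqP => c0; move: h; rewrite c0 !mulr0 add0r => /eqP.
  apply/negP; rewrite mulf_neq0 ?IH 1?ltnW //; apply: ph_neq; lia.
have := c_neq n (leqnn n); rewrite subnn => c00.
have h0 := coef_rel hx (leq0n n); rewrite (_ : (0%N == n) = false) ?mul0r ?addr0 in h0; last by lia.
have h1 := chain_coef_rel2 irr v0 (root_chain_a x) (raise_coef0 _ _ _ _ _) (fun k => root_chain_b k hx) n0.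
rewrite /= -!/(c x _) in h1.
apply: (mulfI qV2_neq0); rewrite mulr0.
have q_np : (q ^+ n.+1) ^+ 2 != 1 by rewrite q_order // ltnS leqnn.
have := elimination_square_one q0 P S q2_neq1 x0 y0 yp1 q_np.
rewrite last_coef_rel mulrAC divff ?mul1r; last exact: ts_neq.
move=> <-; apply: (mulIf c00); rewrite mul0r.
move: h0 h1; rewrite add0r.
move: (ts 0) (ts n.+1) (ts n.+2) (ladder q x 0) (ladder q x 1) (ladder q x n.+1).
move: (ph x 1) (ph x n.+2) (c x 0) (c x 1) (c x n).
move=> p1 p2 c0 c1 cn s0 s1 s2 t0 t1 t2 h0 h1.
transitivity ((s0 * ((t0 - t2) * c0 + cn * c0) + p1 * (c0 + (t1 - t2) * c1 + cn * c1))
  - (s2 * ((t0 - t2) * c0 + cn * c0) + p2 * c0)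
  - (t1 - t2 + cn) * (s0 * c0 + p1 * c1 - s1 * c0)); first by ring.
by rewrite h0 h1 !subrr mulr0 subrr.
Qed.

Lemma cubic_zero : raise_cubic q x y P S ((y * p) ^- 2) = 0.
Proof.
by have [|] := eqVneq ((y * p) ^+ 2) 1; [exact: cubic_zero_square_one | exact: cubic_zero_generic].
Qed.

End NonzeroLast.

(* If c_n <> 0 for the root x, then s/x with s = (y q^(n+1))^2 is another root,
   and each of the two remaining ones works. *)
Lemma terminating_root : exists x, [/\ Q x = 0, ph x n.+1 = 0 & w x n.+1 = 0].
Proof.
have [x hx] := quartic_has_root.
have [c0|cn0] := eqVneq (c x n) 0.
  have phn : ph x n.+1 = 0.
    have := coef_rel hx (leqnn n); rewrite c0 coef_over !mulr0 add0r eqxx mul1r add0r.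
    by move=> <-.
  by exists x; split=> //; apply: chain_end.
have x0 := quartic_root_neq0 hx.
have p0 : q ^+ n != 0 by rewrite expf_neq0.
have hc := cubic_zero hx cn0.
(* All four roots add up to y P, so [t] is the sum of the two unknown ones; their product is
   q^(-2n). *)
set t := y * P - x - (y * q ^+ n * q) ^+ 2 / x.
have [x3 hx3] : exists x3, x3 ^+ 2 = t * x3 - (q ^+ n) ^- 2.
  have [z hz] := solve_monicpoly (nth 0 [:: - (q ^+ n) ^- 2; t]) (isT : (0 < 2)%N).
  by exists z; rewrite hz !big_ord_recr big_ord0 /=; ring.
have x30 : x3 != 0.
  apply/eqP => x30; move: hx3; rewrite x30 expr0n mulr0 /= add0r => /eqP.
  by rewrite eq_sym oppr_eq0 invr_eq0 !expf_eq0 (negbTE q0) !andbF.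
have {}hx3 : x3 + ((q ^+ n) ^+ 2 * x3)^-1 = t.
  have -> : t = (x3 ^+ 2 + (q ^+ n) ^- 2) / x3 by rewrite hx3 subrK mulfK.
  by field; rewrite x30 p0.
have [hQ3 hc3] := switched_root q0 x0 x30 y0 p0 hx hc hx3.
have ph3 : ph x3 n.+1 = 0 by rewrite raise_coefE // [q ^+ n.+1]exprS hc3 mulr0.
exists x3; split=> //; apply: chain_end => // hy.
(* Equality of the two values would give (y q^(2n))^2 = 1 or (y q^(2n+2))^2 = 1, and against [hy]
   either one yields q^2 = 1. *)
have ts_neq i j : (i <= j)%N -> (i + j)%N = (n + n)%N \/ (i + j)%N = (n + n.+2)%N ->
    (0 < j - i <= n.+1)%N -> ts i - ts j != 0.
  move=> ij hij hji; rewrite subr_eq0; apply/eqP => /(ladder_eq q0 y0 ij) [] h.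
    by have := q_order hji; rewrite h eqxx.
  have := q2_neq1; case: hij => e; move: h; rewrite e => h.
    rewrite -[X in X != _]mul1r -[X in X * _]h -exprMn -mulrA -exprSr -addnS hy.
    by rewrite eqxx.
  rewrite -[X in X != _]mul1r -[X in X * _]hy -exprMn -mulrA -exprSr -addnS.
  by rewrite h eqxx.
have ypq : (y * (q ^+ n) ^+ 2 * q) ^+ 2 = 1.
  by rewrite -[RHS]hy addnS [q ^+ (n + n).+1]exprS exprD; ring.
have D20 : ts n.-1 - ts n.+1 != 0 by apply: ts_neq; lia.
have D30 : ts n - ts n.+2 != 0 by apply: ts_neq; lia.
(* Both [x] and [x3] express the trace of [a]. By [switched_trace] the term with [c x n] already
   accounts for the whole difference of the ladder sums, so [c x3 n] is 0. *)
have := switched_trace q0 (n := n.-1) (c := c x n) x0 x30 y0.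
rewrite !prednK // => /(_ P S ypq hc hx3 D20 D30 (last_coef_rel2 hx cn0)) h2.
have := trace_a_root hx; rewrite (trace_a_root hQ3) h2 -exprS => h1.
apply: (mulfI qV_neq0); rewrite mulr0.
move/eqP: h1; rewrite mulrBr addrCA subrr addr0 -[X in _ == X]addr0.
by rewrite (inj_eq (addrI _)) => /eqP.
Qed.

End TerminatingRoot.

(** * Counting eigenvalues by generalized eigenspaces *)

Section EigenvalueCount.
Variables (F : fieldType) (n : nat) (b : 'M[F]_n.+1).

(** The square is taken so that dimension one also excludes a Jordan block at [t]. *)
Definition double_ker (t : F) := kermx ((b - t%:M) *m (b - t%:M)).

Lemma double_kerE t : double_ker t = kermxpoly b (('X - t%:P) ^+ 2).
Proof.
by rewrite /kermxpoly rmorphXn rmorphB /= horner_mx_X horner_mx_C expr2.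
Qed.

(** The double kernels for distinct values are independent. If each had at least the dimension of
    the number of indices sharing its value, the total would be at least N. So some value has a
    smaller kernel, and a fibre of [symm] has at most two elements. *)
Lemma small_double_ker N (x : 'I_N -> F) : injective x -> (forall i, x i != 0) ->
  (n.+1 < N)%N ->
  exists i, \rank (double_ker (symm (x i))) = 0%N \/
    (\rank (double_ker (symm (x i))) = 1%N /\ exists2 k, k != i & x k * x i = 1).
Proof.
move=> xI x0 ltN; pose t i := symm (x i).
suff [i] : exists i, (\rank (double_ker (t i)) < #|[set k | t k == t i]|)%N.
  move=> lti; exists i.
  have inv k : k \in [set k | t k == t i] -> k != i -> x k * x i = 1.
    rewrite inE => /eqP tki nki; case/symm_eq: tki => // /xI ki.
    by rewrite ki eqxx in nki.
  have [/card_le1_eqP le1|] := leqP #|[set k | t k == t i]| 1.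
    left; apply/eqP; rewrite -leqn0 -ltnS (leq_trans lti) //.
    by apply/card_le1_eqP.
  have it : i \in [set k | t k == t i] by rewrite inE.
  rewrite (cardD1 i) it ltnS => /card_gt0P [k]; rewrite !inE => /andP [nki tki].
  have xki : x k * x i = 1 by apply: inv; rewrite ?inE.
  have le2 : (#|[set k | t k == t i]| <= 2)%N.
    apply: leq_trans (_ : #|[set k; i]| <= _)%N; last by rewrite cards2 nki.
    apply/subset_leq_card/subsetP => l lt; rewrite !inE.
    have [->|nli] := eqVneq l i; first by rewrite orbT.
    by rewrite orbF; apply/eqP/xI/(mulIf (x0 i)); rewrite xki inv.
  have := leq_trans lti le2; rewrite ltnS leq_eqVlt ltnS leqn0.
  by case/orP => /eqP; [right; split=> //; exists k | left].
apply/existsP; apply: contraT; rewrite negb_exists => /forallP big.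
(* One chosen index per value of [t], so that the direct sum runs over distinct values. *)
pose rep i := odflt i [pick j | t j == t i].
have t_rep i : t (rep i) = t i.
  by rewrite /rep; case: pickP => [j /eqP //|/(_ i)]; rewrite eqxx.
have rep_eq i j : t i = t j -> rep i = rep j.
  move=> tij; rewrite /rep (eq_pick (_ : _ =1 (fun k => t k == t j))); last first.
    by move=> k; rewrite tij.
  by case: pickP => // /(_ j); rewrite eqxx.
have repK i : rep (rep i) = rep i by apply: rep_eq.
pose P j := rep j == j.
have direct : mxdirect (\sum_(j | P j) kermxpoly b (('X - (t j)%:P) ^+ 2))%MS.
  apply: mxdirect_sum_kermx => i j Pi Pj nij.
  rewrite coprimep_expl ?coprimep_expr // coprimep_XsubC root_XsubC.
  apply: contra nij => /eqP e; rewrite -(eqP Pi) -(eqP Pj); apply/eqP/rep_eq.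
  by [].
suff : (N <= n.+1)%N by rewrite leqNgt ltN.
apply: leq_trans (rank_leq_row (\sum_(j | P j) kermxpoly b (('X - (t j)%:P) ^+ 2))%MS).
rewrite (mxdirectP direct) /= -[X in (X <= _)%N]card_ord -sum1_card.
rewrite (partition_big rep P) => [|i _]; last by rewrite /P repK.
apply: leq_sum => j Pj; rewrite -double_kerE sum1dep_card.
have := big j; rewrite -leqNgt; apply: leq_trans.
apply/subset_leq_card/subsetP => i; rewrite !inE /= => /eqP <-.
by rewrite t_rep.
Qed.

End EigenvalueCount.

(** * Existence of a highest vector *)

Section HighestVector.
Variables (F : fieldType) (q : F) (n : nat) (a b : 'M[F]_n.+1) (k1 g : F).
Hypothesis q0 : q != 0.
Hypothesis q4 : q ^+ 4 != 1.
Hypothesis rel1 : a *m b *m b - (q ^+ 2 + q ^- 2) *: (b *m a *m b) + b *m b *m a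
   + (q ^+ 2 - q ^- 2) ^+ 2 *: a = k1%:M - g *: b.

Local Notation N x := (b - (symm x)%:M).

Definition eigenvector y (v : 'rV[F]_n.+1) := v != 0 /\ v *m b = symm y *: v.

Definition highest y (v : 'rV[F]_n.+1) :=
  exists mu, v *m a *m b - symm (y * q ^+ 2) *: (v *m a) = mu *: v.

Lemma mulN x (v : 'rV[F]_n.+1) : v *m N x = v *m b - symm x *: v.
Proof. by rewrite mulmxBr mul_mx_scalar. Qed.

(** On an eigenvector the first cubic relation becomes quadratic in [b] acting on [v *m a], and this
    quadratic has the two neighbouring ladder values as roots. *)
Lemma rel1_eigen y (v : 'rV[F]_n.+1) : y != 0 -> v *m b = symm y *: v ->
  v *m a *m N (y * q ^+ 2) *m N (y / q ^+ 2) = (k1 - g * symm y) *: v.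
Proof.
move=> y0 vb; have := congr1 (mulmx v) rel1.
rewrite !(mulmxDr, mulmxBr, mulmxN) -!scalemxAr !mulmxA mul_mx_scalar vb.
rewrite -!scalemxAl vb -scalemxAl => h.
have -> : (k1 - g * symm y) *: v = k1 *: v - g *: (symm y *: v).
  by rewrite scalerBl scalerA.
rewrite -h.
rewrite !mul_mx_scalar mulmxBl -!scalemxAl.
move: (v *m a *m b *m b) (v *m a *m b) (v *m a) => w2 w1 w0.
apply/rowP => j; rewrite !mxE /symm; field; rewrite ?y0 ?q0 //.
Qed.

(** The scalar on the right of [rel1_eigen] is absorbed into [mu]. It depends on [y] alone, which
    makes the map [up] in [simple_next] linear. *)
Lemma kernel_shift y : y != 0 -> symm y != symm (y / q ^+ 2) ->
  exists mu, forall v : 'rV[F]_n.+1, v *m b = symm y *: v ->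
    (v *m a *m N (y * q ^+ 2) - mu *: v) *m N (y / q ^+ 2) = 0.
Proof.
move=> y0 ny; exists ((k1 - g * symm y) / (symm y - symm (y / q ^+ 2))) => v vb.
rewrite mulmxBl rel1_eigen // -scalemxAl mulN vb -scalerBl scalerA divfK ?subrr //.
by rewrite subr_eq0.
Qed.

Lemma highest_of_missing y v : y != 0 -> eigenvector y v ->
  (forall u, ~ eigenvector (y / q ^+ 2) u) -> highest y v.
Proof.
move=> y0 [v0 vb] no; have ny : symm y != symm (y / q ^+ 2).
  by apply/eqP => h; apply: (no v); split; rewrite // vb h.
have [mu hmu] := kernel_shift y0 ny; exists mu; have := hmu _ vb.
set u := _ - _ => hu; rewrite -mulN; apply/eqP; rewrite -subr_eq0 -/u.
apply/negPn/negP => un0; apply: (no u); split=> //.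
by apply/eqP; rewrite -subr_eq0 -mulN hu.
Qed.

Definition simple x (v : 'rV[F]_n.+1) := eigenvector x v /\
  forall w : 'rV[F]_n.+1, w *m N x *m N x = 0 -> exists c, w = c *: v.

(** * Propagation of simple eigenvalues in the absence of highest vectors *)

Hypothesis no_highest : forall y v, y != 0 -> eigenvector y v -> ~ highest y v.

Lemma eigen_down y v : y != 0 -> eigenvector y v -> exists u, eigenvector (y / q ^+ 2) u.
Proof.
move=> y0 hv; have [h|h] := boolP (row_free (N (y / q ^+ 2))); last first.
  have /rowV0Pn [u /sub_kermxP uN u0] : kermx (N (y / q ^+ 2)) != 0 by rewrite kermx_eq0.
  by exists u; split=> //; apply/eqP; rewrite -subr_eq0 -mulN uN.
case: (no_highest y0 hv); apply: highest_of_missing => // u [u0 ub].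
by case/eqP: u0; apply: (row_free_inj h); rewrite mul0mx mulN ub subrr.
Qed.

Lemma eigenvectorV y v : eigenvector y v -> eigenvector y^-1 v.
Proof. by rewrite /eigenvector symm_inv. Qed.

(** Inverting y preserves the eigenvalue and exchanges the two directions. *)
Lemma eigen_up y v : y != 0 -> eigenvector y v -> exists u, eigenvector (y * q ^+ 2) u.
Proof.
move=> y0 hv; have [|u hu] := eigen_down _ (eigenvectorV hv); first by rewrite invr_eq0.
by exists u; rewrite -[y * _]invrK invfM; apply: eigenvectorV.
Qed.

Section SimpleStep.
Variables (x : F) (v0 : 'rV[F]_n.+1).
Hypotheses (x0 : x != 0) (hv0 : simple x v0) (x1 : x ^+ 2 != 1).

(** Otherwise the lower neighbour of 1/x is x itself. Then [rel1_eigen] puts a vector into the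
    double kernel at x, which is the line of [v0], and [v0] becomes highest for 1/x. *)
Lemma simple_not_mirror : x ^+ 2 * q ^+ 2 != 1.
Proof.
apply/eqP => xq; have [[v00 v0b] hx] := hv0.
have xi0 : x^-1 != 0 by rewrite invr_eq0.
case: (no_highest xi0 (eigenvectorV hv0.1)).
have xE : x^-1 / q ^+ 2 = x.
  apply: (mulIf (mulf_neq0 x0 (expf_neq0 2 q0))).
  by rewrite [RHS]mulrA -[x * x]expr2 xq; field; rewrite x0 q0.
have v0b' : v0 *m b = symm x^-1 *: v0 by rewrite symm_inv.
have := rel1_eigen xi0 v0b'; rewrite xE => h.
case: (hx (v0 *m a *m N (x^-1 * q ^+ 2))) => [|c hc].
  by rewrite h -scalemxAl mulN v0b subrr scaler0.
by exists c; rewrite -hc mulN.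
Qed.

Lemma symm_next_neq : symm (x * q ^+ 2) - symm x != 0.
Proof.
rewrite subr_eq0; apply/eqP => /symm_eq [||h|h] //.
- by rewrite mulf_neq0 ?expf_neq0.
- case/eqP: q4; rewrite -[4%N]/(2 * 2)%N exprM -[in LHS](mulKf x0 (q ^+ 2)) h.
  by rewrite mulVf ?expr1n.
- by case/eqP: simple_not_mirror; rewrite -h; ring.
Qed.

(** Otherwise both neighbours of x q^2 carry the eigenvalue [symm x]. Correcting [v *m a] by a
    multiple of [v] then lands in the line of [v0], and [v] becomes highest. *)
Lemma simple_next_not_one : (x * q ^+ 2) ^+ 2 != 1.
Proof.
apply/eqP => y1; have [hv hx] := hv0.
have y0 : x * q ^+ 2 != 0 by rewrite mulf_neq0 ?expf_neq0.
have [v [vn0 vb]] := eigen_up x0 hv.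
case: (no_highest y0 (conj vn0 vb)).
have := rel1_eigen y0 vb.
have -> : x * q ^+ 2 / q ^+ 2 = x by rewrite mulfK ?expf_neq0.
have mirror : symm (x * q ^+ 2 * q ^+ 2) = symm x.
  rewrite -(symm_inv x); congr symm; apply: (mulIf x0); rewrite mulVf // -y1; ring.
rewrite mirror; set ka := k1 - _; set D := symm (x * q ^+ 2) - symm x => h.
have D0 : D != 0 := symm_next_neq.
have vN : v *m N x = D *: v by rewrite mulN vb scalerBl.
case: (hx (v *m a - (ka / D ^+ 2) *: v)) => [|c hc].
  rewrite !mulmxBl h -!scalemxAl vN -!scalemxAl vN !scalerA.
  by rewrite -mulrA -expr2 divfK ?expf_neq0 ?subrr.
have : (v *m a - (ka / D ^+ 2) *: v) *m N x = 0.
  by rewrite hc -scalemxAl mulN hv.2 subrr scaler0.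
rewrite mulmxBl -scalemxAl vN => /eqP; rewrite subr_eq0 => /eqP e.
by exists (ka / D ^+ 2 * D); rewrite -scalerA -e mulN mirror.
Qed.

(** The map [up] sends the eigenspace at x q^2 injectively into the line of [v0], so that eigenspace
    is a line. A Jordan block above it is excluded by reading the first cubic relation modulo the
    image of [N x]. *)
Lemma simple_next : exists v, simple (x * q ^+ 2) v.
Proof.
have [hv hx] := hv0.
have y0 : x * q ^+ 2 != 0 by rewrite mulf_neq0 ?expf_neq0.
have yq : x * q ^+ 2 / q ^+ 2 = x by rewrite mulfK ?expf_neq0.
have ny : symm (x * q ^+ 2) != symm (x * q ^+ 2 / q ^+ 2).
  by rewrite yq -subr_eq0 symm_next_neq.
have [mu hmu] := kernel_shift y0 ny; rewrite yq in hmu.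
pose up (v : 'rV[F]_n.+1) := v *m a *m N (x * q ^+ 2 * q ^+ 2) - mu *: v.
have up_v0 (v : 'rV[F]_n.+1) : v *m b = symm (x * q ^+ 2) *: v -> exists c, up v = c *: v0.
  by move=> vb; apply: hx; rewrite (hmu _ vb) mul0mx.
have up_neq0 v : eigenvector (x * q ^+ 2) v -> up v != 0.
  move=> hv'; apply/eqP => /eqP; rewrite subr_eq0 mulN => /eqP e.
  by apply: (no_highest y0 hv'); exists mu.
(* A row vector is annihilated by [f] exactly when it lies in the image of [N x]. *)
have [f f_def] : exists f, f = cokermx (N x) by exists (cokermx (N x)).
have Nf : N x *m f = 0 by rewrite f_def mulmx_coker.
have bf : b *m f = symm x *: f.
  by apply/eqP; rewrite -subr_eq0 -mul_scalar_mx -mulmxBl Nf.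
have eigen_f v : eigenvector (x * q ^+ 2) v -> v *m f = 0 /\ v *m a *m f != 0.
  move=> hv'; have [vn0 vb] := hv'.
  have vf : v *m f = 0.
    apply/eqP; have := congr1 (mulmx v) Nf; rewrite mulmx0 mulmxA mulN vb -scalerBl.
    by rewrite -scalemxAl => /eqP; rewrite scaler_eq0 (negbTE symm_next_neq).
  split=> //; apply/eqP => vaf.
  have [c hc] := up_v0 _ vb.
  have c0 : c != 0 by apply: contra (up_neq0 _ hv') => /eqP c0; rewrite hc c0 scale0r.
  have v0f : v0 *m f = 0.
    apply: (scalerI c0); rewrite scaler0 scalemxAl -hc /up mulmxBl -scalemxAl vf scaler0 subr0.
    by rewrite -(mulmxA (v *m a)) mulmxBl mul_scalar_mx bf -scalerBl -scalemxAr vaf scaler0.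
  have /submxP [z hz] : (v0 <= N x)%MS by rewrite submxE -f_def v0f.
  have [|c' hc'] := hx z; first by rewrite -hz mulN hv.2 subrr.
  by case/eqP: hv.1; rewrite hz hc' -scalemxAl mulN hv.2 subrr scaler0.
have [v hv'] := eigen_up x0 hv; exists v; split=> // w hw.
have [vn0 vb] := hv'.
have one_dim w' : w' *m N (x * q ^+ 2) = 0 -> exists c, w' = c *: v.
  rewrite mulN => /eqP; rewrite subr_eq0 => /eqP w'b.
  have [c hc] := up_v0 _ vb; have [c' hc'] := up_v0 _ w'b.
  have c0 : c != 0 by apply: contra (up_neq0 _ hv') => /eqP c0; rewrite hc c0 scale0r.
  exists (c' / c); apply/eqP; rewrite -subr_eq0; apply: contraT => nz.
  have : eigenvector (x * q ^+ 2) (w' - (c' / c) *: v).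
    split=> //; rewrite mulmxBl w'b -scalemxAl vb scalerBr !scalerA.
    by congr (_ - _ *: _); rewrite mulrC.
  move/up_neq0/eqP; case.
  have -> : up (w' - (c' / c) *: v) = up w' - (c' / c) *: up v.
    rewrite /up !mulmxBl -!scalemxAl; move: (w' *m a *m _) (v *m a *m _) => A1 A2.
    by apply/rowP => j; rewrite !mxE; ring.
  by rewrite hc hc' scalerA divfK ?subrr.
apply: one_dim; apply/eqP; apply: contraT => nz.
(* If [w] is not an eigenvector, [u] is one. The relation applied to [w] and then to [f] leaves a
   nonzero multiple of [u *m a *m f], contradicting [eigen_f]. *)
set u := w *m N (x * q ^+ 2) in hw nz *.
have hu : eigenvector (x * q ^+ 2) u.
  by split=> //; apply/eqP; rewrite -subr_eq0 -mulN hw.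
have [uf uaf] := eigen_f _ hu.
have wb : w *m b = symm (x * q ^+ 2) *: w + u by rewrite /u mulN addrC subrK.
have wf : w *m f = 0.
  apply/eqP; have := congr1 (mulmx w) Nf; rewrite mulmx0 mulmxA mulN wb addrAC -scalerBl.
  rewrite mulmxDl uf addr0 -scalemxAl => /eqP.
  by rewrite scaler_eq0 (negbTE symm_next_neq).
case/eqP: uaf.
have fb (z : 'rV[F]_n.+1) : z *m b *m f = symm x *: (z *m f) by rewrite -mulmxA bf -scalemxAr.
have : w *m (k1%:M - g *: b) *m f = 0.
  by rewrite mulmxBr mul_mx_scalar -scalemxAr mulmxBl -!scalemxAl fb wf !scaler0 subrr.
rewrite -rel1.
rewrite !(mulmxDr, mulmxBr, mulmxN) -!scalemxAr !mulmxA.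
rewrite !(mulmxDl, mulmxBl, mulNmx) -!scalemxAl !fb.
have wbb : w *m b *m b = symm (x * q ^+ 2) ^+ 2 *: w + (symm (x * q ^+ 2) *+ 2) *: u.
  rewrite wb mulmxDl -scalemxAl wb hu.2.
  by apply/rowP => j; rewrite !mxE; ring.
rewrite wbb wb !(mulmxDl, mulmxBl, mulNmx) -!scalemxAl.
move: (w *m a *m f) (u *m a *m f) => A V h.
have nz' : (q ^+ 2 - q ^- 2) * (x - x^-1) != 0.
  rewrite mulf_neq0 // subr_eq0; apply/eqP => e.
    by case/eqP: q4; rewrite -[4%N]/(2 + 2)%N exprD {1}e mulVf ?expf_neq0.
  by case/eqP: x1; rewrite expr2 {1}e mulVf.
apply: (scalerI nz'); rewrite scaler0 -h.
apply/rowP => j; rewrite !mxE /symm; field; rewrite ?x0 ?q0 //.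
Qed.

End SimpleStep.

End HighestVector.

Lemma symm_surj (F : closedFieldType) (t : F) : exists2 x, x != 0 & symm x = t.
Proof.
have [x hx] := solve_monicpoly (nth 0 [:: -1; t]) (isT : (0 < 2)%N).
have {}hx : x ^+ 2 = t * x - 1 by rewrite hx !big_ord_recr big_ord0 /=; ring.
have x0 : x != 0.
  apply/eqP => x0; move: hx; rewrite x0 expr0n mulr0 add0r => /eqP.
  by rewrite eq_sym oppr_eq0 oner_eq0.
exists x => //; apply: (mulIf x0); rewrite mulrDl mulVf // -expr2 hx.
by rewrite subrK.
Qed.

(* Without a highest vector every symm (x q^(2i)) is an eigenvalue of b.  As these
   are too many, one of them has a one-dimensional generalized eigenspace and
   occurs as symm of two distinct x q^(2i), x q^(2k).  Simplicity then propagates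
   upwards until the ladder is reflected, which is excluded. *)
Lemma exists_highest (F : closedFieldType) (q : F) n (a b : 'M[F]_n.+1) (k1 g : F) N :
  q != 0 -> (n.+1 < N)%N -> (2 < N)%N -> (q ^+ N) ^+ 2 = 1 ->
  (forall k, (0 < k < N)%N -> (q ^+ k) ^+ 2 != 1) ->
  a *m b *m b - (q ^+ 2 + q ^- 2) *: (b *m a *m b) + b *m b *m a
   + (q ^+ 2 - q ^- 2) ^+ 2 *: a = k1%:M - g *: b ->
  exists y v, [/\ y != 0, eigenvector b y v & highest q a b y v].
Proof.
move=> q0 ltN N2 qN q_order rel1; apply: NNPP => none.
have q4 : q ^+ 4 != 1 by rewrite -[4%N]/(2 * 2)%N exprM q_order.
have no y v : y != 0 -> eigenvector b y v -> ~ highest q a b y v.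
  by move=> y0 hv hh; apply: none; exists y, v.
have [t /eigenvalueP [v vb v0]] : exists t, eigenvalue b t.
  have [t ht] : exists t, root (char_poly b) t.
    by apply/closed_rootP; rewrite size_char_poly.
  by exists t; rewrite eigenvalue_root_char.
have [z z0 zt] := symm_surj t; rewrite -zt in vb.
pose x i := z * (q ^+ i) ^+ 2.
have x0 i : x i != 0 by rewrite mulf_neq0 ?expf_neq0.
have xS i : x i.+1 = x i * q ^+ 2 by rewrite /x [q ^+ i.+1]exprS; ring.
have eigen i : exists u, eigenvector b (x i) u.
  elim: i => [|i [u hu]]; first by exists v; rewrite /x !expr1n mulr1.
  by rewrite xS; apply: (eigen_up q0 rel1 no (x0 i) hu).
have xI : injective (fun i : 'I_N => x i).
  suff lt_neq (i j : 'I_N) : (i < j)%N -> x i != x j.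
    move=> i j xij; apply/val_inj; case: (ltngtP i j) => // /lt_neq; rewrite xij eqxx //.
  move=> ij; apply/eqP => /(mulfI z0); rewrite -[val j](subnKC (ltnW ij)) exprD exprMn => h.
  have qji : (0 < j - i < N)%N by have := ltn_ord j; lia.
  case/eqP: (q_order _ qji); apply: (mulfI (expf_neq0 2 (expf_neq0 i q0))).
  by rewrite mulr1; exact: esym h.
have [i] := small_double_ker b xI (fun i => x0 i) ltN.
have [u [u0 ub]] := eigen i.
have uN : u *m (b - (symm (x i))%:M) = 0 by rewrite mulN ub subrr.
have uker : (u <= double_ker b (symm (x i)))%MS.
  by apply/sub_kermxP; rewrite mulmxA uN mul0mx.
case=> [rk0|[rk1 [k ki xki]]].
  by move: (mxrankS uker); rewrite rk0 rank_rV u0.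
have simple_i : simple b (x i) u.
  split=> // w hw; have wker : (w <= double_ker b (symm (x i)))%MS.
    by apply/sub_kermxP; rewrite mulmxA.
  apply/sub_rVP; apply: submx_trans wker _.
  by rewrite -(mxrank_leqif_sup uker) rk1 rank_rV u0.
have x1 : x i ^+ 2 != 1.
  apply: contra ki => /eqP h; apply/eqP/xI/(mulIf (x0 i)).
  by rewrite xki -h.
have climb s : exists2 w, simple b (x (i + s)%N) w & x (i + s)%N ^+ 2 != 1.
  elim: s => [|s [w hw h1]]; first by exists u; rewrite addn0.
  rewrite addnS xS; have [w' hw'] := simple_next q0 q4 rel1 no (x0 _) hw h1.
  by exists w' => //; apply: (simple_next_not_one q0 q4 rel1 no (x0 _) hw).
(* Chosen so that x_i^2 q^(2j) = x_k x_i q^(2N) = 1. After [j./2] steps the ladder is at its mirror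
   point: x^2 = 1 if j is even, x^2 q^2 = 1 if j is odd. *)
pose j := (k + (N - i))%N.
have ij : x i ^+ 2 * (q ^+ j) ^+ 2 = 1.
  have -> : x i ^+ 2 * (q ^+ j) ^+ 2 = x k * x i * (q ^+ i * q ^+ (N - i)) ^+ 2.
    by rewrite /x /j exprD; ring.
  by rewrite -exprD subnKC ?qN ?xki ?mulr1 // ltnW.
have [w hw h1] := climb j./2.
have xij : x (i + j./2)%N = x i * (q ^+ j./2) ^+ 2 by rewrite /x exprD; ring.
have := odd_double_half j; case: (odd j) => /= hj.
  case/eqP: (simple_not_mirror q0 rel1 no (x0 _) hw).
  by rewrite -[RHS]ij xij -[in RHS]hj add1n [q ^+ _.+1]exprS -addnn exprD; ring.
by case/eqP: h1; rewrite -[RHS]ij xij -[in RHS]hj add0n -addnn exprD; ring.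
Qed.

(** * Schur's lemma, elimination of C and comparison with V_n *)

Section Assembly.
Variables (F : closedFieldType) (q : F).
Hypothesis q0 : q != 0.

Lemma scalar_of_irreducible n (A B C Z : 'M[F]_n.+1) :
  irreducible_mod A B C -> central_in Z A B C -> exists z, Z = z%:M.
Proof.
move=> [_ irr] [ZA ZB ZC].
have [z hz] : exists z, root (char_poly Z^T) z.
  by apply/closed_rootP; rewrite size_char_poly.
exists z; pose U := kermx (Z^T - z%:M).
have inv X : commutes Z X -> Defs.invariant X U.
  move=> ZX; apply/sub_kermxP; rewrite -mulmxA.
  have -> : X^T *m (Z^T - z%:M) = (Z^T - z%:M) *m X^T.
    by rewrite mulmxBr mulmxBl -!trmx_mul ZX scalar_mxC.
  by rewrite mulmxA mulmx_ker mul0mx.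
have [U0|full] := irr U (inv _ ZA) (inv _ ZB) (inv _ ZC).
  move: hz; rewrite -eigenvalue_root_char => /eigenvalueP [v vz v0].
  have : (v <= U)%MS.
    by apply/sub_kermxP; rewrite mulmxBr vz mul_mx_scalar subrr.
  by rewrite U0 submx0 (negbTE v0).
apply: trmx_inj; rewrite tr_scalar_mx; apply/eqP; rewrite -subr_eq0; apply/eqP.
by apply: (row_full_inj full); rewrite mulmx_ker mulmx0.
Qed.

Section Relations.
Variables (n : nat) (A B C : 'M[F]_n) (al be ga : F).
Hypothesis q4 : q ^+ 4 != 1.
Let rho := q ^+ 2 - q ^- 2.
Hypothesis hA : Dq_elt q A B C = al%:M.
Hypothesis hB : Dq_elt q B C A = be%:M.
Hypothesis hC : Dq_elt q C A B = ga%:M.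

Lemma rho_num : (q * q) ^+ 2 - 1 != 0.
Proof. by rewrite subr_eq0 -expr2 -exprM. Qed.

Lemma generator_C : C = ga%:M - rho^-1 *: (q *: (A *m B) - q^-1 *: (B *m A)).
Proof. by rewrite -hC /Dq_elt addrK. Qed.

Lemma cubic_rel1 :
  A^T *m B^T *m B^T - (q ^+ 2 + q ^- 2) *: (B^T *m A^T *m B^T) + B^T *m B^T *m A^T
   + rho ^+ 2 *: A^T = (rho ^+ 2 * al)%:M - (rho * (q - q^-1) * ga) *: B^T.
Proof.
have -> : A^T *m B^T *m B^T = (B *m B *m A)^T by rewrite !trmx_mul mulmxA.
have -> : B^T *m A^T *m B^T = (B *m A *m B)^T by rewrite !trmx_mul mulmxA.
have -> : B^T *m B^T *m A^T = (A *m B *m B)^T by rewrite !trmx_mul mulmxA.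
have : rho ^+ 2 *: Dq_elt q A B C = (rho ^+ 2 * al)%:M by rewrite hA scale_scalar_mx.
rewrite /Dq_elt generator_C !mulmxBr !mulmxBl mul_mx_scalar mul_scalar_mx.
rewrite -!scalemxAr -!scalemxAl !mulmxBr !mulmxBl -!scalemxAr -!scalemxAl !mulmxA => hS.
rewrite -[(rho ^+ 2 * _)%:M]tr_scalar_mx -hS.
move: hS => _.
move: (B *m A *m B) (A *m B *m B) (B *m B *m A) => M1 M2 M3.
apply/matrixP => i j; rewrite !mxE.
by rewrite /rho; field; rewrite q0 rho_num.
Qed.

Lemma cubic_rel2 :
  B^T *m A^T *m A^T - (q ^+ 2 + q ^- 2) *: (A^T *m B^T *m A^T) + A^T *m A^T *m B^T
   + rho ^+ 2 *: B^T = (rho ^+ 2 * be)%:M - (rho * (q - q^-1) * ga) *: A^T.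
Proof.
have -> : B^T *m A^T *m A^T = (A *m A *m B)^T by rewrite !trmx_mul mulmxA.
have -> : A^T *m B^T *m A^T = (A *m B *m A)^T by rewrite !trmx_mul mulmxA.
have -> : A^T *m A^T *m B^T = (B *m A *m A)^T by rewrite !trmx_mul mulmxA.
have : rho ^+ 2 *: Dq_elt q B C A = (rho ^+ 2 * be)%:M by rewrite hB scale_scalar_mx.
rewrite /Dq_elt generator_C !mulmxBr !mulmxBl mul_mx_scalar mul_scalar_mx.
rewrite -!scalemxAr -!scalemxAl !mulmxBr !mulmxBl -!scalemxAr -!scalemxAl !mulmxA => hS.
rewrite -[(rho ^+ 2 * _)%:M]tr_scalar_mx -hS.
move: hS => _.
move: (A *m B *m A) (A *m A *m B) (B *m A *m A) => M1 M2 M3.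
apply/matrixP => i j; rewrite !mxE.
by rewrite /rho; field; rewrite q0 rho_num.
Qed.

End Relations.
Lemma thetaE x n i : x != 0 -> theta q (x * q ^+ n) (q ^+ n) i = ladder q x i.
Proof.
move=> x0; rewrite /theta /ladder /symm -!exprnN -!exprnP mulnC exprM.
move: (q ^+ n) (expf_neq0 n q0) (q ^+ i) (expf_neq0 i q0) => r r0 p p0.
by field; rewrite x0 r0 p0.
Qed.

(** By [hr] the cubic has the root q^(2n+2); this yields the factor of [phi] vanishing at i = n+1
    and determines [S]. By [hc] the remaining quadratic splits into the two factors with c and
    1/c. *)
Lemma phiE x y c P S n i : x != 0 -> y != 0 -> c != 0 ->
  (q ^+ n.+1) ^+ 2 != 1 -> raise_coef q x y P S n.+1 = 0 ->
  symm c = (P - x / y - (x * y * (q ^+ n) ^+ 2)^-1) / (q ^+ n * q) ->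
  phi q (x * q ^+ n) (y * q ^+ n) c (q ^+ n) i = raise_coef q x y P S i /\
  gamma_val q (x * q ^+ n) (y * q ^+ n) c (q ^+ n) = P + S.
Proof.
move=> x0 y0 c0 qn hr hc.
have r0 := expf_neq0 n q0; have p0 := expf_neq0 i q0.
have P_def : P = x / y + (x * y * (q ^+ n) ^+ 2)^-1 + q ^+ n * q * symm c.
  by rewrite hc; field; rewrite q0 r0 x0 y0.
have cubic0 : raise_cubic q x y P S ((q ^+ n.+1) ^+ 2) = 0.
  move/eqP: hr; rewrite raise_coefE // mulf_eq0 => /orP [|/eqP //].
  rewrite mulf_eq0 invr_eq0 !expf_eq0 (negbTE q0) !andbF orbF subr_eq0 => /eqP h.
  by case/eqP: qn; rewrite expr2 {1}h mulVf ?expf_neq0.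
have S_def : S = (x * y / q ^+ 2 * ((q ^+ n * q) ^+ 2) ^+ 3
    + y / x * ((q ^+ n * q) ^+ 2) ^+ 2
    + (P - x / y) * (q ^+ n * q) ^+ 2 - q ^+ 2 / (x * y)) / ((q ^+ n * q) ^+ 2) ^+ 2.
  rewrite -[LHS]addr0 -(mul0r (((q ^+ n * q) ^+ 2) ^+ 2)^-1) -cubic0 /raise_cubic [q ^+ n.+1]exprSr.
  by field; rewrite q0 r0 y0 x0.
rewrite /phi /gamma_val /raise_coef !expfzDr // -?exprnN -?exprnP.
rewrite S_def P_def /symm.
move: (q ^+ n) r0 (q ^+ i) p0 => r r0 p p0.
by split; field; rewrite c0 q0 r0 x0 y0 ?p0.
Qed.

(** The intertwiner has the chain vectors as columns. It respects C because C is given by the same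
    expression in A and B on both sides. *)
Lemma mod_iso_of_chain n (A B C : 'M[F]_n.+1) (w : nat -> 'rV[F]_n.+1) aa bb cc ga :
  chain_mx w \in unitmx -> w n.+1 = 0 ->
  (forall k, (k <= n)%N -> w k *m A^T = w k.+1 + theta q aa (q ^+ n) k *: w k) ->
  phi q aa bb cc (q ^+ n) 0 = 0 ->
  (forall k, (k <= n)%N -> w k *m B^T = theta q bb (q ^+ n) k *: w k + phi q aa bb cc (q ^+ n) k *: w k.-1) ->
  C = ga%:M - (q ^+ 2 - q ^- 2)^-1 *: (q *: (A *m B) - q^-1 *: (B *m A)) ->
  gamma_val q aa bb cc (q ^+ n) / (q + q^-1) = ga ->
  mod_iso (Vn_A q aa n) (Vn_B q aa bb cc n) (Vn_C q aa bb cc n) A B C.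
Proof.
move=> unit wn wa ph0 wb C_def ga_def.
pose U := (chain_mx w)^T; exists U.
have pick (f : nat -> 'rV[F]_n.+1) k :
    \sum_(j < n.+1) (if j == k :> nat then f j else 0) = if (k < n.+1)%N then f k else 0.
  by rewrite -big_mkcond big_ord1_eq.
have UA : U *m Vn_A q aa n = A *m U.
  apply: trmx_inj; rewrite !trmx_mul !trmxK; apply/row_matrixP => i.
  rewrite !row_mul rowK wa -1?ltnS // mulmx_sum_row.
  transitivity (\sum_(j < n.+1) (if j == i :> nat then theta q aa (q ^+ n) j *: w j else 0)
    + \sum_(j < n.+1) (if j == i.+1 :> nat then w j else 0)).
    rewrite -big_split; apply: eq_bigr => j _; rewrite !mxE rowK /=.
    have [->|ne] := eqVneq (j : nat) (i : nat); first by rewrite ltn_eqF ?addr0.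
    by rewrite add0r; case: ifP => _; rewrite ?scale1r ?scale0r.
  rewrite (pick (fun j => theta q aa (q ^+ n) j *: w j)) (pick w) ltn_ord addrC.
  congr (_ + _); case: ltnP => // ni.
  by rewrite (_ : i.+1 = n.+1) ?wn //; have := ltn_ord i; lia.
have UB : U *m Vn_B q aa bb cc n = B *m U.
  apply: trmx_inj; rewrite !trmx_mul !trmxK; apply/row_matrixP => i.
  rewrite !row_mul rowK wb -1?ltnS // mulmx_sum_row.
  transitivity (\sum_(j < n.+1) (if j == i :> nat then theta q bb (q ^+ n) j *: w j else 0)
    + \sum_(j < n.+1) (if j == i.-1 :> nat then phi q aa bb cc (q ^+ n) i *: w j else 0)).
    rewrite -big_split; apply: eq_bigr => j _; rewrite !mxE rowK /=.
    have [ji|ne] := eqVneq (j : nat) (i : nat).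
      (* Both conditions hold together only for i = 0, where [i.-1] is again 0; there [phi]
         vanishes. *)
      case: (eqVneq (j : nat) (i : nat).-1) => [ij|_]; last by rewrite addr0 ji.
      have i_0 : (i : nat) = 0%N by move: ij; rewrite ji; case: (nat_of_ord i) => //= k /eqP; rewrite eqn_leq ltnn.
      by rewrite ji i_0 ph0 scale0r addr0.
    rewrite add0r; have [i0|i0] := posnP i.
      by rewrite i0 ph0 /= !scale0r; case: ifP.
    by rewrite -[in _ == _](prednK i0) eqSS; case: ifP => _; rewrite ?scale0r.
  rewrite (pick (fun j => theta q bb (q ^+ n) j *: w j)).
  rewrite (pick (fun j => phi q aa bb cc (q ^+ n) i *: w j)) ltn_ord.
  by rewrite (leq_ltn_trans (leq_pred _) (ltn_ord i)).
split=> //.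
  by rewrite mxrank_tr mxrank_unit.
rewrite C_def /Vn_C ga_def mulmxBr mulmxBl mul_mx_scalar mul_scalar_mx.
rewrite -!scalemxAr -!scalemxAl mulmxBr mulmxBl -!scalemxAr -!scalemxAl !mulmxA.
by rewrite UA UB -!mulmxA UA UB.
Qed.

End Assembly.

(** * The order of q^2 and the final isomorphism *)

Lemma dprime_order (F : fieldType) (q : F) d :
  d.-primitive_root q -> d \notin [:: 1%N; 2%N; 4%N] ->
  [/\ q != 0, (2 < dprime d)%N, (q ^+ dprime d) ^+ 2 = 1 &
      forall k, (0 < k < dprime d)%N -> (q ^+ k) ^+ 2 != 1].
Proof.
move=> hq hd; have d0 := prim_order_gt0 hq.
have q0 : q != 0.
  apply/eqP => q0; have /eqP := prim_expr_order hq.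
  by rewrite q0 expr0n -[d == 0%N]negbK -lt0n d0 /= eq_sym oner_eq0.
have dvd k : ((q ^+ k) ^+ 2 == 1) = (d %| k * 2)%N by rewrite -exprM (prim_order_dvd hq).
have dvdE k : (d %| k * 2)%N = (dprime d %| k)%N.
  rewrite /dprime; case: ifP => od; first by rewrite Gauss_dvdl // coprimen2.
  by rewrite -{1}(even_halfK (negbT od)) -muln2 dvdn_pmul2r.
split=> //.
- move: hd; rewrite !inE /dprime; have := odd_double_half d; case: (odd d) => /=; lia.
- by apply/eqP; rewrite dvd dvdE.
- move=> k /andP [k0 kd]; rewrite dvd dvdE; apply/negP => /(dvdn_leq k0).
  by rewrite leqNgt kd.
Qed.

Section IrreducibleModule.
Variables (F : closedFieldType) (q : F) (N n : nat) (A B C : 'M[F]_n.+1).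
Hypotheses (q0 : q != 0) (N2 : (2 < N)%N) (qN : (q ^+ N) ^+ 2 = 1).
Hypothesis q_order : forall k, (0 < k < N)%N -> (q ^+ k) ^+ 2 != 1.
Hypothesis hmod : is_Dq_module q A B C.
Hypothesis hirr : irreducible_mod A B C.
Hypothesis hdim : (n.+1 < N)%N.

Let q4 : q ^+ 4 != 1.
Proof. by rewrite -[4%N]/(2 * 2)%N exprM q_order. Qed.

Let qp0 : q * q + 1 != 0.
Proof.
apply: contra q4 => /eqP h; have {}h : q ^+ 2 = -1.
  by rewrite expr2 -[LHS](addrK 1) h sub0r.
by rewrite -[4%N]/(2 * 2)%N exprM h sqrrN expr1n.
Qed.

Let qm0 : q * q - 1 != 0.
Proof.
by rewrite subr_eq0 -expr2; have := q_order (k := 1); rewrite expr1; apply; lia.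
Qed.

Let qsum0 : q + q^-1 != 0.
Proof.
apply: contra qp0 => /eqP h.
have -> : q * q + 1 = q * (q + q^-1) by rewrite mulrDr mulfV.
by rewrite h mulr0.
Qed.

Lemma module_scalars : exists al be ga,
  [/\ Dq_elt q A B C = al%:M, Dq_elt q B C A = be%:M & Dq_elt q C A B = ga%:M].
Proof.
have [zA zB zC] := hmod.
have [al hal] := scalar_of_irreducible hirr zA.
have [be hbe] := scalar_of_irreducible hirr zB.
have [ga hga] := scalar_of_irreducible hirr zC.
by exists al, be, ga.
Qed.

(** C is a combination of 1, A B and B A, so stability under A and B implies stability under C. *)
Lemma pair_irreducible_tr ga : Dq_elt q C A B = ga%:M -> pair_irreducible A^T B^T.
Proof.
move=> hC U UA UB; apply: hirr.2; [exact: UA | exact: UB | rewrite /Defs.invariant].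
have -> : C^T = ga%:M - (q ^+ 2 - q ^- 2)^-1 *: (q *: (B^T *m A^T) - q^-1 *: (A^T *m B^T)).
  rewrite [in LHS](generator_C hC) -!trmx_mul -[ga%:M]tr_scalar_mx.
  by move: (A *m B) (B *m A) => M1 M2; apply/matrixP => i j; rewrite !mxE eq_sym.
rewrite mulmxBr mul_mx_scalar -scalemxAr mulmxBr -!scalemxAr !mulmxA.
have UBA : (U *m B^T *m A^T <= U)%MS by apply: submx_trans UA; apply: submxMr.
have UAB : (U *m A^T *m B^T <= U)%MS by apply: submx_trans UB; apply: submxMr.
rewrite addmx_sub ?scalemx_sub // eqmx_opp scalemx_sub //.
by rewrite addmx_sub ?scalemx_sub // eqmx_opp scalemx_sub.
Qed.

Lemma iso_Vn : exists a b c, [/\ a != 0, b != 0, c != 0 &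
  mod_iso (Vn_A q a n) (Vn_B q a b c n) (Vn_C q a b c n) A B C].
Proof.
have [al [be [ga [hA hB hC]]]] := module_scalars.
have C_def := generator_C hC.
have irr := pair_irreducible_tr hC.
(* Dimension one is direct, as [terminating_root] assumes n > 0: lambda is 1, A and B fix [symm aa]
   and [symm bb], and the value of gamma fixes [symm cc]. *)
have [n0|n0] := posnP n.
  have [aa aa0 haa] := symm_surj (A ord0 ord0).
  have [bb bb0 hbb] := symm_surj (B ord0 ord0).
  have [cc cc0 hcc] := symm_surj (ga - symm aa * symm bb / (q + q^-1)).
  exists aa, bb, cc; split=> //.
  pose w k : 'rV[F]_n.+1 := if k is 0%N then const_mx 1 else 0.
  have all0 (i : 'I_n.+1) : i = ord0.
    by apply/val_inj; case: i => k /=; rewrite n0 ltnS leqn0 => /eqP.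
  have le0 k : (k <= n)%N -> k = 0%N by rewrite n0 leqn0 => /eqP.
  have one_mx (M : 'M[F]_n.+1) : M = (M ord0 ord0)%:M.
    by apply/matrixP => i j; rewrite mxE (all0 i) (all0 j) eqxx.
  have th0 x : theta q x (q ^+ n) 0 = symm x.
    by rewrite /theta n0 !expr0 muln0 oppr0 expr0z invr1 !mulr1.
  have ph0 : phi q aa bb cc (q ^+ n) 0 = 0 by rewrite /phi oppr0 subrr mulr0 !mul0r.
  apply: (mod_iso_of_chain q0 (w := w) (ga := ga)) => //.
  - by rewrite (one_mx (chain_mx w)) !mxE unitmx1.
  - move=> k /le0 ->.
    by rewrite [A]one_mx tr_scalar_mx mul_mx_scalar th0 haa add0r.
  - move=> k /le0 ->.
    by rewrite ph0 scale0r addr0 [B]one_mx tr_scalar_mx mul_mx_scalar th0 hbb.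
  - rewrite /gamma_val n0 expr0 invr1 !mul1r -/(symm aa) -/(symm bb) -/(symm cc) hcc.
    by rewrite mulrDl mulfK ?qsum0 // addrC subrK.
have rel1 := cubic_rel1 q0 q4 hA hC.
have rel2 := cubic_rel2 q0 q4 hB hC.
set rho := q ^+ 2 - q ^- 2 in rel1 rel2.
have [y [v [y0 [v0 vb] [mu vab]]]] := exists_highest q0 hdim N2 qN q_order rel1.
set g := rho * (q - q^-1) * ga in rel1 rel2.
set k2 := rho ^+ 2 * be in rel2.
(* [P] and [S] solve the linear system P + S = G, P/q - S q = M; [E] is solved from the formula for
   [k2]. *)
pose G := g / (q - q^-1) ^+ 2; pose M := mu / (q - q^-1).
pose P := (M + G * q) / (q + q^-1); pose S := (G / q - M) / (q + q^-1).
pose E := k2 * y / ((q - q^-1) ^+ 2 * (1 + q^-2)) - y ^+ 2 - q ^+ 2.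
have hg : g = (q - q^-1) ^+ 2 * (P + S).
  by rewrite /P /S /G; field; rewrite q0 qp0 qm0.
have hmu : mu = (q - q^-1) * (P / q - S * q).
  by rewrite /P /S /M; field; rewrite q0 qp0 qm0.
have hk2 : k2 = (q - q^-1) ^+ 2 * (1 + q^-2) / y * (E + y ^+ 2 + q ^+ 2).
  by rewrite /E; field; rewrite q0 expr2 qp0 qm0 y0.
have q_order' k : (0 < k <= n.+1)%N -> (q ^+ k) ^+ 2 != 1.
  by move=> hk; apply: q_order; lia.
have [x [hQ hr hw]] := terminating_root q0 q_order' n0 y0 v0 irr hg hmu hk2 rel2 vb vab.
have x0 := quartic_root_neq0 q0 y0 hQ.
have r0 : q ^+ n != 0 by rewrite expf_neq0.
have [c c0 hc] := symm_surj ((P - x / y - (x * y * (q ^+ n) ^+ 2)^-1) / (q ^+ n * q)).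
have qn1 : (q ^+ n.+1) ^+ 2 != 1 by apply: q_order'; rewrite ltnS leqnn.
have phE i := phiE q0 i x0 y0 c0 qn1 hr hc.
exists (x * q ^+ n), (y * q ^+ n), c; split=> //; try exact: mulf_neq0.
apply: (mod_iso_of_chain q0 (w := chain A^T (ladder q x) v) (ga := ga)) => //.
- exact: (chain_mx_unit irr v0 (chain_mul _ _ _) (fun k => root_chain_b q0 y0 hg hmu hk2 rel2 vb vab k hQ)).
- by move=> k _; rewrite thetaE // chain_mul.
- by rewrite (phE 0%N).1 raise_coef0.
- move=> k _; rewrite thetaE // (phE k).1.
  exact: (root_chain_b q0 y0 hg hmu hk2 rel2 vb vab k hQ).
rewrite (phE 0%N).2.
have -> : P + S = g / (q - q^-1) ^+ 2 by rewrite hg; field; rewrite qm0 q0.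
by rewrite /g /rho; field; rewrite q0 qp0 qm0.
Qed.

End IrreducibleModule.

Unset Implicit Arguments.

Theorem theorem1p6 (F : closedFieldType) (q : F) (d : nat)
  (hq : d.-primitive_root q) (hd : d \notin [:: 1%N; 2%N; 4%N])
  (m : nat) (A B C : 'M[F]_m)
  (hmod : is_Dq_module q A B C) (hirr : irreducible_mod A B C)
  (hdim : (m < dprime d)%N) :
  exists (a b c : F) (n : nat),
    [/\ a != 0, b != 0, c != 0, (n <= dprime d - 2)%N &
        mod_iso (Vn_A q a n) (Vn_B q a b c n) (Vn_C q a b c n) A B C].
Proof.
have [q0 N2 qN q_order] := dprime_order hq hd.
case: m A B C hmod hirr hdim => [|n] A B C hmod hirr hdim; first by case: hirr.
have [a [b [c [a0 b0 c0 iso]]]] := iso_Vn q0 N2 qN q_order hmod hirr hdim.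
by exists a, b, c, n; split=> //; move: hdim; case: (dprime d) => [|[|N]] //; rewrite subn2.
Qed.
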